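(* Let $A$ be a bounded unital $*$-algebra over $\mathbb{C}$ with unit $e$. Then the following hold. (1) For every $x\in A$, $|x|$ coincides with the norm of $x$ in the universal enveloping $C^*$-algebra $C^*(A)$, i.e. $|x|=\sup_{\pi}\|\pi(x)\|$, where $\pi$ runs over all $*$-representations of $A$ by bounded operators on Hilbert spaces. Thus $$\sup_{\pi}\|\pi(x)\|^2=\inf\{r\in\mathbb{R},\ r>0 : xx^*+f=re\ \text{ for some } f\in A_+\}.$$ Moreover, $\|a\|=|a|$ for every self-adjoint $a\in A$. (2) The null-space $\{x\in A: |x|=0\}$ equals $R^*(A)$, and it consists of those $x\in A$ such that for every $\varepsilon>0$ there are $x_1,\dots,x_n\in A$ satisfying $$x^*x+\sum_{j=1}^n x_j^*x_j=\varepsilon e .$$ (3) $A$ is $C^*$-representable if and only if $R^*(A)=\{0\}$.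
   Context: For a unital $*$-algebra $A$ with unit $e$, $A_{sa}$ is the set of self-adjoint elements and $A_+=\{\sum_{i=1}^n a_i^*a_i : n\ge 1,\ a_i\in A\}$. For $a,b\in A_{sa}$ write $a\ge b$ if $a-b\in A_+$. An element $a\in A_{sa}$ is bounded if $\alpha e\ge a\ge-\alpha e$ for some real $\alpha\ge 0$; an element $x=a+ib$ with $a,b\in A_{sa}$ is bounded if $a$ and $b$ are; the algebra $A$ is bounded if all its elements are bounded. For $a\in A_{sa}$ put $\|a\|=\inf\{r>0: re+a\in A_+ \text{ and } re-a\in A_+\}$, and for $x\in A$ put $|x|=\sqrt{\|x^*x\|}$. A $*$-representation by bounded operators is a $*$-homomorphism of $A$ into the algebra of bounded operators on a Hilbert space (the zero representation is allowed). $C^*(A)$ is the universal enveloping $C^*$-algebra of $A$ (it exists because $A$ is bounded). $R^*(A)$, the $*$-radical, is the intersection of the kernels of all topologically irreducible $*$-representations of $A$ by bounded operators on Hilbert spaces (equal to $A$ if there are none). $A$ is $C^*$-representable if it is $*$-isomorphic to a $*$-subalgebra of a $C^*$-algebra (equivalently, has an injective $*$-representation by bounded operators on a Hilbert space). *)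

(* Defs.v *)
From HB Require Import structures.
From mathcomp Require Import all_boot all_order all_algebra.
From mathcomp Require Import complex.
From mathcomp Require Import all_classical all_reals all_analysis.

Set Implicit Arguments.
Unset Strict Implicit.
Unset Printing Implicit Defensive.

Import Order.TTheory GRing.Theory Num.Theory.
Import numFieldNormedType.Exports.

Local Open Scope classical_set_scope.
Local Open Scope complex_scope.
Local Open Scope ring_scope.

(* The product is a field of the structure, and not that of a library ring, for
   two reasons: a C*-algebra need not have a unit, and the rings carrying a
   module structure in the library satisfy [1 != 0], which would exclude the
   zero algebra. *)
HB.mixin Record isStarAlgebra (R : realType) (A : Type)
    of GRing.Lmodule R[i] A := {
  amul : A -> A -> A ;
  star : A -> A ;
  amulA : forall a b c : A, amul a (amul b c) = amul (amul a b) c ;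
  amulDl : forall a b c : A, amul (a + b) c = amul a c + amul b c ;
  amulDr : forall a b c : A, amul a (b + c) = amul a b + amul a c ;
  amulZl : forall (k : R[i]) (a b : A), amul (k *: a) b = k *: amul a b ;
  amulZr : forall (k : R[i]) (a b : A), amul a (k *: b) = k *: amul a b ;
  starD : forall a b : A, star (a + b) = star a + star b ;
  starZ : forall (k : R[i]) (a : A), star (k *: a) = Num.conj k *: star a ;
  starM : forall a b : A, star (amul a b) = amul (star b) (star a) ;
  starK : forall a : A, star (star a) = a
}.

#[short(type="starAlgType")]
HB.structure Definition StarAlgebra (R : realType) :=
  {A of GRing.Lmodule R[i] A & isStarAlgebra R A}.

Notation "a ** b" := (amul a b) (at level 40, left associativity) : ring_scope.

HB.mixin Record hasAlgebraUnit (R : realType) (A : Type)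
    of StarAlgebra R A := {
  aone : A ;
  amul1a : forall a : A, aone ** a = a ;
  amula1 : forall a : A, a ** aone = a
}.

#[short(type="unitalStarAlgType")]
HB.structure Definition UnitalStarAlgebra (R : realType) :=
  {A of StarAlgebra R A & hasAlgebraUnit R A}.

(* The norm of a normed module over [R[i]] takes its values in [R[i]]. *)
HB.mixin Record isCStarAlgebra (R : realType) (B : Type)
    of CompleteNormedModule R[i] B & StarAlgebra R B := {
  cnorm_mul_le : forall a b : B, `|a ** b| <= `|a| * `|b| ;
  cnorm_star_mul : forall a : B, `|star a ** a| = `|a| ^+ 2
}.

#[short(type="cstarAlgType")]
HB.structure Definition CStarAlgebra (R : realType) :=
  {B of CompleteNormedModule R[i] B & StarAlgebra R B & isCStarAlgebra R B}.

HB.mixin Record isHilbert (R : realType) (H : Type)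
    of CompleteNormedModule R[i] H := {
  hdot : {dot H for (@Num.conj R[i])} ;
  hdot_norm : forall v : H, hdot v v = `|v| ^+ 2
}.

#[short(type="hilbertType")]
HB.structure Definition Hilbert (R : realType) :=
  {H of CompleteNormedModule R[i] H & isHilbert R H}.

Section Definitions.
Variable R : realType.

(* Morphisms are not required to preserve a unit, even when there is one. *)
Definition star_morphism (V W : starAlgType R) (f : V -> W) : Prop :=
  [/\ linear f,
      forall a b, f (a ** b) = f a ** f b &
      forall a, f (star a) = star (f a)].

Definition star_subalgebra (B : cstarAlgType R) (S : set B) : Prop :=
  [/\ S 0,
      forall (k : R[i]) a b, S a -> S b -> S (k *: a + b),
      forall a b, S a -> S b -> S (a ** b) &
      forall a, S a -> S (star a)].

(* Bounded operators are linear continuous maps; [`|T v|] is a nonnegative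
   real complex number, hence the real part. *)
Definition opnorm (H : hilbertType R) (T : H -> H) : \bar R :=
  ereal_sup [set (complex.Re `|T v|)%:E | v in [set v : H | `|v| <= 1]].

Section Algebra.
Variable A : unitalStarAlgType R.
Local Notation e := (aone : A).
Implicit Types (a b x : A) (r : R).

Definition selfadj : set A := [set a | star a = a].

Definition apos : set A := [set a | exists n (b : 'I_n.+1 -> A),
  a = \sum_(i < n.+1) star (b i) ** b i].

Definition age a b : Prop := apos (a - b).

Definition bounded_sa a : Prop := exists r,
  [/\ 0 <= r, age (r%:C *: e) a & age a (- (r%:C *: e))].

Definition bounded_elt x : Prop := exists a b,
  [/\ selfadj a, selfadj b, x = a + 'i *: b, bounded_sa a & bounded_sa b].

Definition bounded_algebra : Prop := forall x, bounded_elt x.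

Definition norm_sa a : R :=
  inf [set r | [/\ 0 < r, apos (r%:C *: e + a) & apos (r%:C *: e - a)]].

Definition anorm x : R := Num.sqrt (norm_sa (star x ** x)).

Definition star_rep (H : hilbertType R) (pi : A -> H -> H) : Prop :=
  [/\ forall a, linear (pi a) /\ continuous (pi a),
      forall v, linear (pi ^~ v),
      forall a b v, pi (a ** b) v = pi a (pi b v) &
      forall a u v, hdot (pi a u) v = hdot u (pi (star a) v)].

Definition topologically_irreducible (H : hilbertType R) (pi : A -> H -> H) :
    Prop :=
  (exists v : H, v != 0) /\
  forall V : set H, closed V -> V 0 ->
    (forall (k : R[i]) u v, V u -> V v -> V (k *: u + v)) ->
    (forall a v, V v -> V (pi a v)) ->
    V = [set 0] \/ V = setT.

Definition rep_norms x : set (\bar R) :=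
  [set s | exists (H : hilbertType R) (pi : A -> H -> H),
    star_rep pi /\ s = opnorm (pi x)].

Definition star_radical : set A :=
  [set x | forall (H : hilbertType R) (pi : A -> H -> H),
    star_rep pi -> topologically_irreducible pi -> forall v, pi x v = 0].

(* [B], together with [iota], is the universal enveloping C*-algebra: every
   *-homomorphism into a C*-algebra factors uniquely through [iota]. *)
Definition universal_enveloping (B : cstarAlgType R) (iota : A -> B) : Prop :=
  star_morphism iota /\
  forall (D : cstarAlgType R) (phi : A -> D),
    star_morphism phi ->
    exists! psi : B -> D,
      star_morphism psi /\
      forall a, psi (iota a) = phi a.

Definition cstar_representable : Prop :=
  exists (B : cstarAlgType R) (S : set B) (phi : A -> B),
    [/\ star_subalgebra S, star_morphism phi &
        set_bij [set: A] S phi].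

End Algebra.
End Definitions.

Arguments selfadj {R} A _.
Arguments apos {R} A _.
Arguments star_radical {R} A _.

(* Main.v *)
Require Import Defs.
From HB Require Import structures.
From mathcomp Require Import all_boot all_order all_algebra.
From mathcomp Require Import complex ring lra.
From mathcomp Require Import all_classical all_reals all_analysis.

Set Implicit Arguments.
Unset Strict Implicit.
Unset Printing Implicit Defensive.

Import Order.TTheory GRing.Theory Num.Theory.
Import numFieldNormedType.Exports.

Local Open Scope classical_set_scope.
Local Open Scope complex_scope.
Local Open Scope ring_scope.

(** The number [|x|], the square root of [inf {r > 0 : r - x^* x in A_+}],
    is a C*-seminorm, and this is pure algebra: every axiom reduces to writing
    some element as a sum of terms [y^* a y] with [a] in [A_+]
    ([norm_sa_anorm], [anormM], [anormD]). The completion of [A] for it is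
    therefore a C*-algebra, the candidate for the enveloping one.

    Why it is the enveloping one: if [phi] maps [A] to a C*-algebra [D], then
    [r - x^* x] in [A_+] makes [r p - phi(x)^* phi(x)] a sum of squares in [D],
    with [p] the image of the unit, and sums of squares in a C*-algebra are
    positive, so [|phi(x)|^2 <= r]. Hence [phi] is bounded by the seminorm and
    extends. The positivity of [x^* x] is proved without spectral theory. Call
    [a] positive when [|t p - a| <= t] for some [t >= 0], which is obviously
    stable under sums; square roots [1 - y] of [1 - h] come from iterating
    [y := (h + y^2) / 2]; and norms are bounded by the remark that commuting
    self-adjoint [h] and [s] with [h^2 + s^2 = 1] make [h + i s] unitary
    ([exists_root], [unitary_mean_le1]). Kaplansky's argument then applies
    ([cpos_star_mul]). The same remark shows that morphisms between C*-algebras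
    are contractive ([star_morphism_contractive]), whence the uniqueness of the
    extension and the value of the norm in any enveloping algebra.

    Representations by operators satisfy [|pi(x)| <= |x|] by the same
    computation with vectors ([rep_bound]). Conversely let [p(x)] be the infimum
    of the [r > 0] with [r - Re x] in [A_+]. It is sublinear, the functionals
    below it are the states, and [p(x^* x) = |x|^2]. Some state [F] attains
    this value at [x^* x] and is an extreme point of the set of states
    ([extreme_functional], by Zorn's lemma on sublinear functionals). In the
    representation built from [F] the cyclic vector [xi] has norm at most 1 and
    [|pi(x) xi|^2 = F(x^* x) = |x|^2]. If [|x| != 0] this representation is
    irreducible, because an invariant closed subspace would split [F] into two
    states ([extreme_irreducible]). So [|x|] is the supremum of the norms, and
    the elements killed by all irreducible representations are those with
    [|x| = 0]. When there are no other such elements than 0, [A] embeds in its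
    completion, and a [*]-algebra embedded in a C*-algebra has no others, since
    morphisms are bounded by the seminorm. *)

(** * Linear identities in a module *)

Section LinearExpressions.
Variables (K : pzRingType) (V : lmodType K).

Inductive lexp : Type :=
| LZero | LAtom of nat | LAdd of lexp & lexp | LOpp of lexp
| LScale of K & lexp | LMuln of lexp & nat.

Fixpoint leval (env : seq V) (e : lexp) : V :=
  match e with
  | LZero => 0
  | LAtom n => nth 0 env n
  | LAdd a b => leval env a + leval env b
  | LOpp a => - leval env a
  | LScale k a => k *: leval env a
  | LMuln a n => leval env a *+ n
  end.

Fixpoint lcoef (e : lexp) (i : nat) : K :=
  match e with
  | LZero => 0
  | LAtom n => if eqn n i then 1 else 0
  | LAdd a b => lcoef a i + lcoef b i
  | LOpp a => - lcoef a i
  | LScale k a => k * lcoef a i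
  | LMuln a n => lcoef a i *+ n
  end.

Lemma levalE env e : leval env e = \sum_(i < size env) lcoef e i *: env`_i.
Proof.
elim: e => [|n|a IHa b IHb|a IHa|k a IHa|a IHa n] /=.
- by rewrite big1 // => i _; rewrite scale0r.
- have [ltn|gen] := ltnP n (size env).
    rewrite (bigD1 (Ordinal ltn)) //= (introT eqnP erefl) scale1r big1 ?addr0//.
    move=> i /eqP ni; case: eqnP => [e|]; last by rewrite scale0r.
    by case: ni; apply: val_inj.
  rewrite nth_default // big1 // => i _; case: eqnP => [e|]; last by rewrite scale0r.
  by move: gen; rewrite e leqNgt ltn_ord.
- by rewrite IHa IHb -big_split; apply: eq_bigr => i _; rewrite scalerDl.
- by rewrite IHa -sumrN; apply: eq_bigr => i _; rewrite scaleNr.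
- by rewrite IHa scaler_sumr; apply: eq_bigr => i _; rewrite scalerA.
- by rewrite IHa -sumrMnl; apply: eq_bigr => i _; rewrite scalerMnl.
Qed.

Fixpoint lcoef_eq (n : nat) (a b : lexp) : Prop :=
  if n is m.+1 then lcoef a m = lcoef b m /\ lcoef_eq m a b else True.

Lemma leval_eq env a b : lcoef_eq (size env) a b -> leval env a = leval env b.
Proof.
move=> ab; rewrite !levalE; apply: eq_bigr => -[i /= ilt] _; congr (_ *: _).
move: ab ilt; elim: (size env) => [|n IH] //= [e ab].
by rewrite ltnS leq_eqVlt => /predU1P[->|/IH]; last exact.
Qed.

End LinearExpressions.

(* Atoms are compared up to conversion: the same product may carry its
   structure along two inheritance paths. *)
Ltac latom_add x l :=
  let rec go m := lazymatch m with
    | nil => constr:(x :: l)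
    | cons ?y ?m' => match constr:(Set) with
      | _ => let _ := constr:(erefl x : x = y) in l
      | _ => go m'
      end
    end in go l.

Ltac latoms l e := lazymatch e with
  | @GRing.zero _ => l
  | @GRing.add _ ?a ?b => let l1 := latoms l a in latoms l1 b
  | @GRing.opp _ ?a => latoms l a
  | @GRing.scale _ _ _ ?a => latoms l a
  | @GRing.natmul _ ?a _ => latoms l a
  | _ => latom_add e l
  end.

Ltac lindex x l := lazymatch l with
  | cons ?y ?m => match constr:(Set) with
    | _ => let _ := constr:(erefl x : x = y) in constr:(0%N)
    | _ => let n := lindex x m in constr:(S n)
    end
  end.

Ltac lreify K l e := lazymatch e with
  | @GRing.zero _ => constr:(@LZero K)
  | @GRing.add _ ?a ?b => let a' := lreify K l a in let b' := lreify K l b in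
      constr:(@LAdd K a' b')
  | @GRing.opp _ ?a => let a' := lreify K l a in constr:(@LOpp K a')
  | @GRing.scale _ _ ?k ?a => let a' := lreify K l a in constr:(@LScale K k a')
  | @GRing.natmul _ ?a ?n => let a' := lreify K l a in constr:(@LMuln K a' n)
  | _ => let n := lindex e l in constr:(@LAtom K n)
  end.

(** Reduces an identity between linear combinations over the ring [K] of
    arbitrary vectors to the equality of their coefficients. *)
Ltac linear_identity_over K :=
  lazymatch goal with |- @eq ?V ?a ?b =>
    let l0 := latoms (@nil V) a in
    let l := latoms l0 b in
    let a' := lreify K l a in
    let b' := lreify K l b in
    apply: (@leval_eq K _ l a' b');
    cbn [lcoef lcoef_eq size eqn]; do ?[split=> //]
  end.

(** * *-algebras *)

Section StarAlgebraTheory.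
Variables (R : realType) (A : starAlgType R).
Implicit Types (a b c x y : A) (k : R[i]) (r : R).

Lemma amulNl a b : (- a) ** b = - (a ** b).
Proof. by rewrite -scaleN1r amulZl scaleN1r. Qed.
Lemma amulNr a b : a ** (- b) = - (a ** b).
Proof. by rewrite -scaleN1r amulZr scaleN1r. Qed.
Lemma amul0l a : 0 ** a = 0.
Proof. by rewrite -[0 in LHS](scale0r a) amulZl scale0r. Qed.
Lemma amul0r a : a ** 0 = 0.
Proof. by rewrite -[0 in LHS](scale0r a) amulZr scale0r. Qed.
Lemma amulBl a b c : (a - b) ** c = a ** c - b ** c.
Proof. by rewrite amulDl amulNl. Qed.
Lemma amulBr a b c : a ** (b - c) = a ** b - a ** c.
Proof. by rewrite amulDr amulNr. Qed.

Lemma conjCr r : Num.conj (r%:C : R[i]) = r%:C.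
Proof. by apply: conj_Creal; rewrite realE !lecR; exact: le_total. Qed.

Lemma starN a : star (- a) = - star a.
Proof. by rewrite -scaleN1r starZ conjCN1 scaleN1r. Qed.
Lemma star0 : star (0 : A) = 0.
Proof. by rewrite -[X in star X](scale0r 0) starZ conjC0 scale0r. Qed.
Lemma starB a b : star (a - b) = star a - star b.
Proof. by rewrite starD starN. Qed.
Lemma starZr r a : star (r%:C *: a) = r%:C *: star a.
Proof. by rewrite starZ conjCr. Qed.
Lemma starZi a : star ('i *: a) = - 'i *: star a.
Proof. by rewrite starZ conjCi. Qed.
Lemma amul_suml n (f : 'I_n -> A) b : (\sum_i f i) ** b = \sum_i f i ** b.
Proof. by rewrite (big_morph (amul^~ b) (fun x y => amulDl x y b) (amul0l b)). Qed.
Lemma amul_sumr n (f : 'I_n -> A) b : b ** (\sum_i f i) = \sum_i b ** f i.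
Proof. by rewrite (big_morph (amul b) (amulDr b) (amul0r b)). Qed.

Definition amulE := (@amulDl R A, @amulDr R A, amulNl, amulNr, @amulZl R A,
  @amulZr R A, @amulA R A, amul0l, amul0r).
Definition starE := (@starD R A, starN, starZr, starZi, @starM R A, @starK R A,
  star0).

End StarAlgebraTheory.

Lemma star1 (R : realType) (A : unitalStarAlgType R) : star (aone : A) = aone.
Proof. by rewrite -[LHS]amul1a -{1}[aone]starK -starM amul1a starK. Qed.

(** Products are expanded into left-associated words, which then serve as the
    atoms of a linear identity. *)
Ltac star_identity R :=
  rewrite ?starE ?amulE; linear_identity_over constr:(R[i]).

(** * Real-valued norms and sequences *)

Lemma realC_neq0 (R : realType) (r : R) : r != 0 -> r%:C != 0 :> R[i].
Proof. by move=> r0; rewrite eq_complex /= eqxx andbT. Qed.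

Lemma realC_gt0 (R : realType) (r : R[i]) : 0 < r -> 0 < complex.Re r /\ r = (complex.Re r)%:C.
Proof. by case: r => a b /andP[/eqP /= -> a0]. Qed.

(** Norms over [R[i]] are complex numbers; all the estimates are made on their
    real parts. *)
Definition nrm (R : realType) (V : normedZmodType R[i]) (x : V) : R :=
  complex.Re `|x|.

Lemma normE (R : realType) (V : normedZmodType R[i]) (x : V) : `|x| = (nrm x)%:C.
Proof.
rewrite /nrm; have : 0 <= `|x| by [].
by case: `|x| => a b /andP[/eqP /= -> _].
Qed.

Section NormTheory.
Variables (R : realType) (V : normedModType R[i]).
Implicit Types (x y : V) (k : R[i]) (r : R).

Lemma nrm_ge0 x : 0 <= nrm x.
Proof. by rewrite -lecR -normE; exact: normr_ge0. Qed.

Lemma nrm0 : nrm (0 : V) = 0. Proof. by rewrite /nrm normr0. Qed.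

Lemma nrm0_eq0 x : nrm x = 0 -> x = 0.
Proof. by move=> h; apply/eqP; rewrite -normr_eq0 normE h. Qed.

Lemma nrmD x y : nrm (x + y) <= nrm x + nrm y.
Proof. by rewrite -lecR rmorphD /= -!normE ler_normD. Qed.

Lemma nrmN x : nrm (- x) = nrm x. Proof. by rewrite /nrm normrN. Qed.

Lemma nrmBC x y : nrm (x - y) = nrm (y - x).
Proof. by rewrite -nrmN opprB. Qed.

Lemma nrm_triangle y x z : nrm (x - z) <= nrm (x - y) + nrm (y - z).
Proof. by rewrite -[x - z](subrKA y) nrmD. Qed.

Lemma nrmZ k x : nrm (k *: x) = nrm k * nrm x.
Proof. by apply/complexI; rewrite rmorphM /= -!normE normrZ. Qed.

Lemma nrm_real r : nrm (r%:C : R[i]) = `|r|.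
Proof. by rewrite /nrm normc_def /= expr0n addr0 sqrtr_sqr. Qed.

Lemma nrmZr r x : nrm (r%:C *: x) = `|r| * nrm x.
Proof. by rewrite nrmZ nrm_real. Qed.

Lemma nrm_sub_le x y : nrm x - nrm y <= nrm (x - y).
Proof. by rewrite lerBlDr -{1}(subrK y x) nrmD. Qed.

End NormTheory.

Section Sequences.
Variables (R : realType) (V : zmodType) (N : V -> R).

Definition cauchy_wrt (u : nat -> V) := forall e, 0 < e ->
  exists n0, forall m n, (n0 <= m)%N -> (n0 <= n)%N -> N (u m - u n) < e.

Definition tends (u : nat -> V) (l : V) := forall e, 0 < e ->
  exists n0, forall n, (n0 <= n)%N -> N (u n - l) < e.

End Sequences.

Lemma cauchy_seq_cvg (K : numFieldType) (V : completeNormedModType K)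
    (u : nat -> V) :
  (forall e, 0 < e -> exists n0, forall m n, (n0 <= m)%N -> (n0 <= n)%N ->
     `|u m - u n| < e) ->
  exists l, forall e, 0 < e -> exists n0, forall n, (n0 <= n)%N -> `|u n - l| < e.
Proof.
move=> cu.
have : cauchy (u @ \oo).
  apply/cauchyP => e e0; have [n0 h] := cu e e0.
  exists (u n0); exists n0 => // n /= le_n.
  by rewrite /ball_ -ball_normE /= h.
move=> /cauchy_cvg ul; exists (lim (u @ \oo)) => e e0.
have /cvgrPdist_lt/(_ _ e0) [n0 _ h] := ul.
by exists n0 => n /h /=; rewrite distrC.
Qed.

Lemma nrm_complete (R : realType) (V : completeNormedModType R[i]) (u : nat -> V) :
  cauchy_wrt (@nrm R V) u -> exists l, tends (@nrm R V) u l.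
Proof.
move=> cu; have [|l h] := @cauchy_seq_cvg _ V u.
  move=> e /realC_gt0[e0 ->]; have [n0 h] := cu _ e0.
  by exists n0 => m n hm hn; rewrite normE ltcR h.
exists l => e e0; have [|n0 hn] := h e%:C; first by rewrite ltcR.
by exists n0 => n /hn; rewrite normE ltcR.
Qed.

Lemma real_complete (R : realType) (u : nat -> R) :
  cauchy_wrt (@Num.norm R R) u -> exists l, tends (@Num.norm R R) u l.
Proof. exact: cauchy_seq_cvg. Qed.

Lemma tends_unique (R : realType) (V : normedModType R[i]) (u : nat -> V) (l m : V) :
  tends (@nrm R V) u l -> tends (@nrm R V) u m -> l = m.
Proof.
move=> ul um; apply/eqP; rewrite -subr_eq0; apply/eqP/nrm0_eq0/eqP.
rewrite eq_le nrm_ge0 andbT; apply/ler_addgt0Pr => e e0; rewrite add0r.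
have e2 : 0 < e / 2 by rewrite divr_gt0.
have [n1 h1] := ul _ e2; have [n2 h2] := um _ e2.
have {h1} := h1 (maxn n1 n2) (leq_maxl _ _).
have {h2} := h2 (maxn n1 n2) (leq_maxr _ _).
have := nrm_triangle (u (maxn n1 n2)) l m.
rewrite (nrmBC l (u _)); lra.
Qed.

(** The form in which inequalities are passed to the limit. *)
Lemma le_all_eps (R : realType) (a b c : R) : 0 <= c ->
  (forall e, 0 < e -> a <= b + c * e) -> a <= b.
Proof.
move=> c0 h; apply/ler_addgt0Pr => e e0.
have d0 : 0 < c + 1 by lra.
have := h (e / (c + 1)); rewrite divr_gt0 // => /(_ isT).
move=> /le_trans; apply; rewrite lerD2l mulrA ler_pdivrMr //; nra.
Qed.

(** * Square roots and positivity in a C*-algebra *)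

Section SquareRootScalar.
Variable R : realType.

(** The scalar instance of the iteration that computes [1 - sqrt (1 - h)]; it
    dominates the iterates in the algebra. *)
Fixpoint majorant (n : nat) : R :=
  if n is m.+1 then (1 + majorant m ^+ 2) / 2 else 0.

Lemma majorant_bounds n : 0 <= majorant n <= 1.
Proof. by elim: n => [|n /andP[h0 h1]] /=; rewrite ?lexx ?ler01 //; apply/andP; split; nra. Qed.

Lemma majorant_le_succ n : majorant n <= majorant n.+1.
Proof.
elim: n => [|n IH]; first by rewrite /=; lra.
have /andP[h0 h1] := majorant_bounds n.
have /andP[h2 h3] := majorant_bounds n.+1.
rewrite -[majorant n.+2]/((1 + majorant n.+1 ^+ 2) / 2).
rewrite -[X in X <= _]/((1 + majorant n ^+ 2) / 2).
by rewrite ler_pM2r ?invr_gt0 // lerD2l ler_sqr.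
Qed.

Lemma majorant_le m n : (m <= n)%N -> majorant m <= majorant n.
Proof.
apply: (@homo_leq _ majorant (fun x y => x <= y)); last exact: majorant_le_succ.
- by move=> x; exact: lexx.
- by move=> x y z; exact: le_trans.
Qed.

Lemma majorant_cauchy : cauchy_wrt (@Num.norm R R) majorant.
Proof.
have hs : has_sup (range majorant).
  split; first by exists 0; exists 0%N.
  by exists 1 => _ [n _ <-]; have /andP[] := majorant_bounds n.
move=> e e0; have [_ [n0 _ <-] hn0] := sup_adherent e0 hs.
have ub n : majorant n <= sup (range majorant).
  by apply: ub_le_sup; [case: hs | exists n].
exists n0 => m n /majorant_le hm /majorant_le hn; rewrite ltr_norml.
by move: (ub m) (ub n); lra.
Qed.

End SquareRootScalar.

Section CStarTheory.
Variables (R : realType) (D : cstarAlgType R).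
Implicit Types (a b c h p s x y z : D).
Local Notation nr := (@nrm R D).

Lemma nrm_amul a b : nr (a ** b) <= nr a * nr b.
Proof. by rewrite -lecR rmorphM /= -!normE cnorm_mul_le. Qed.

Lemma nrm_cstar a : nr (star a ** a) = nr a ^+ 2.
Proof. by apply/complexI; rewrite rmorphXn /= -!normE cnorm_star_mul. Qed.

(** [|b|^2 = |b^* b| <= |b^*| |b|], and symmetrically. *)
Lemma nrm_star a : nr (star a) = nr a.
Proof.
have le b : nr b <= nr (star b).
  have [->|b0] := eqVneq b 0; first by rewrite star0.
  have nb : 0 < nr b.
    rewrite lt_def nrm_ge0 andbT; apply: contra_neq b0; exact: nrm0_eq0.
  by rewrite -(ler_pM2r nb) -expr2 -nrm_cstar nrm_amul.
by apply/le_anti/andP; split; [have := le (star a); rewrite starK | exact: le].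
Qed.

Lemma nrm_sa a : star a = a -> nr (a ** a) = nr a ^+ 2.
Proof. by move=> sa; rewrite -nrm_cstar sa. Qed.

Lemma sa_sqr_eq0 a : star a = a -> a ** a = 0 -> a = 0.
Proof.
move=> sa a0; apply: nrm0_eq0; apply/eqP; rewrite -sqrf_eq0 -nrm_sa // a0.
by rewrite nrm0.
Qed.

Lemma tends_amull (u : nat -> D) l c : tends nr u l -> tends nr (fun n => c ** u n) (c ** l).
Proof.
move=> ul e e0; have c1 : 0 < nr c + 1 by have := nrm_ge0 c; lra.
have [|n0 h] := ul (e / (nr c + 1)); first by rewrite divr_gt0.
exists n0 => n /h; rewrite ltr_pdivlMr // => hn.
rewrite -amulBr; apply: le_lt_trans (nrm_amul _ _) _.
by apply: le_lt_trans hn; have := nrm_ge0 (u n - l); nra.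
Qed.

Lemma tends_star (u : nat -> D) l : tends nr u l -> tends nr (fun n => star (u n)) (star l).
Proof.
move=> ul e /ul[n0 h]; exists n0 => n /h.
by rewrite -starB nrm_star.
Qed.

Lemma tends_amulr (u : nat -> D) l c : tends nr u l -> tends nr (fun n => u n ** c) (l ** c).
Proof.
move=> ul e e0; have c1 : 0 < nr c + 1 by have := nrm_ge0 c; lra.
have [|n0 h] := ul (e / (nr c + 1)); first by rewrite divr_gt0.
exists n0 => n /h; rewrite ltr_pdivlMr // => hn.
rewrite -amulBl; apply: le_lt_trans (nrm_amul _ _) _.
by apply: le_lt_trans hn; have := nrm_ge0 (u n - l); nra.
Qed.

Section Root.
Variable h : D.
Hypotheses (h_sa : star h = h) (h_le1 : nr h <= 1).

Fixpoint root_iter (n : nat) : D :=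
  if n is m.+1 then (2^-1)%:C *: (h + root_iter m ** root_iter m) else 0.

Local Notation y_ := root_iter.

Lemma half_norm a : nr ((2^-1)%:C *: a) = nr a / 2.
Proof. by rewrite nrmZr ger0_norm ?invr_ge0 // mulrC. Qed.

Lemma root_iter_bound n : nr (y_ n) <= majorant R n.
Proof.
elim: n => [|n IH]; first by rewrite nrm0.
rewrite /= half_norm ler_pM2r ?invr_gt0 //.
apply: le_trans (nrmD _ _) (lerD h_le1 _).
by apply: le_trans (nrm_amul _ _) _; rewrite expr2 ler_pM ?nrm_ge0.
Qed.

(** The algebra obeys the same recurrence as the scalars: the increment of
    [y^2] is [y (y - z) + (y - z) z], bounded by [v^2 - w^2] when [v] and [w]
    bound [y] and [z] and [v - w] bounds [y - z]. *)
Lemma root_iter_step n : nr (y_ n.+1 - y_ n) <= majorant R n.+1 - majorant R n.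
Proof.
elim: n => [|n IH].
  rewrite /= subr0 amul0l addr0 half_norm subr0 expr0n /= addr0 div1r.
  by have := h_le1; lra.
have -> : y_ n.+2 - y_ n.+1 =
    (2^-1)%:C *: (y_ n.+1 ** (y_ n.+1 - y_ n) + (y_ n.+1 - y_ n) ** y_ n).
  rewrite -[y_ n.+2]/((2^-1)%:C *: (h + y_ n.+1 ** y_ n.+1)).
  rewrite -[in X in _ - X = _]/(_ *: (h + y_ n ** y_ n)).
  rewrite [X in _ - X = _]/=; move: (y_ n.+1) (y_ n) => a b.
  by star_identity R; ring.
rewrite half_norm.
have b1 := root_iter_bound n.+1; have b0 := root_iter_bound n.
have m1 := nrm_amul (y_ n.+1) (y_ n.+1 - y_ n).
have m0 := nrm_amul (y_ n.+1 - y_ n) (y_ n).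
have t := nrmD (y_ n.+1 ** (y_ n.+1 - y_ n)) ((y_ n.+1 - y_ n) ** y_ n).
rewrite -[majorant R n.+2]/((1 + majorant R n.+1 ^+ 2) / 2).
rewrite -[X in _ <= _ - X]/((1 + majorant R n ^+ 2) / 2).
have g1 := nrm_ge0 (y_ n.+1); have g0 := nrm_ge0 (y_ n).
have gd := nrm_ge0 (y_ n.+1 - y_ n).
set d := nr (y_ n.+1 - y_ n) in IH m1 m0 gd *.
set v1 := majorant R n.+1 in b1 IH *; set v0 := majorant R n in b0 IH *.
have i1 : nr (y_ n.+1) * d <= v1 * (v1 - v0) by apply: ler_pM.
have i0 : d * nr (y_ n) <= (v1 - v0) * v0 by apply: ler_pM.
nra.
Qed.

Lemma root_iter_dist m n : (n <= m)%N -> nr (y_ m - y_ n) <= majorant R m - majorant R n.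
Proof.
elim: m => [|m IH]; first by rewrite leqn0 => /eqP ->; rewrite !subrr nrm0.
rewrite leq_eqVlt => /predU1P[->|]; first by rewrite !subrr nrm0.
rewrite ltnS => /IH h1; have h2 := root_iter_step m.
by have := nrm_triangle (y_ m) (y_ m.+1) (y_ n); lra.
Qed.

Lemma root_iter_cauchy : cauchy_wrt nr y_.
Proof.
move=> e e0; have [n0 hn] := majorant_cauchy e0.
exists n0 => m n hm hn0; wlog le_nm : m n hm hn0 / (n <= m)%N => [hw|].
  by have [/hw|/ltnW/hw] := leqP n m; [exact|rewrite nrmBC; exact].
apply: le_lt_trans (root_iter_dist le_nm) _.
by apply: le_lt_trans (ler_norm _) _; exact: hn.
Qed.

(** [1 - y] is the positive square root of [1 - h], written without a unit.
    Whatever commutes with [h] commutes with the iterates, which are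
    polynomials in [h], hence with [y]; likewise for [p ** h = h]. *)
Lemma exists_root : exists y, [/\ star y = y, nr y <= 1, h = y + y - y ** y,
  forall c, c ** h = h ** c -> c ** y = y ** c &
  forall p, p ** h = h -> p ** y = y].
Proof.
have [y yl] := nrm_complete root_iter_cauchy.
have y_sa : star y = y.
  apply: (tends_unique (tends_star yl)); suff: forall n, star (y_ n) = y_ n.
    by move=> e; rewrite (_ : (fun n => _) = y_) //; exact/funext.
  by elim=> [|n IH] /=; rewrite ?star0 // !starE h_sa IH.
have y1 : nr y <= 1.
  apply: (@le_all_eps R _ _ 1) => // e e0; have [n0 /(_ n0 (leqnn _)) hn] := yl _ e0.
  have := root_iter_bound n0; have /andP[_] := majorant_bounds R n0.
  by have := nrm_sub_le y (y_ n0); rewrite nrmBC; lra.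
exists y; split=> //.
- suff e : y = (2^-1)%:C *: (h + y ** y).
    suff -> : y + y = h + y ** y by rewrite addrK.
    by rewrite {1 2}e; star_identity R; field.
  have yl1 : tends nr (fun n => y_ n.+1) y.
    by move=> e /yl[n0 hn]; exists n0 => n /leqW /hn.
  apply: (tends_unique yl1) => e e0; have [n0 hn] := yl _ e0.
  exists n0 => n /hn dn.
  have -> : y_ n.+1 - (2^-1)%:C *: (h + y ** y) =
      (2^-1)%:C *: (y_ n ** (y_ n - y) + (y_ n - y) ** y).
    rewrite /=; move: (y_ n) => b; star_identity R; ring.
  rewrite half_norm.
  have m1 := nrm_amul (y_ n) (y_ n - y); have m0 := nrm_amul (y_ n - y) y.
  have t := nrmD (y_ n ** (y_ n - y)) ((y_ n - y) ** y).
  have b : nr (y_ n) <= 1.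
    by apply: le_trans (root_iter_bound n) _; have /andP[] := majorant_bounds R n.
  have gd := nrm_ge0 (y_ n - y).
  have i1 : nr (y_ n) * nr (y_ n - y) <= nr (y_ n - y) by rewrite ler_piMl.
  have i0 : nr (y_ n - y) * nr y <= nr (y_ n - y) by rewrite ler_piMr.
  lra.
- move=> c ch; apply: (tends_unique (tends_amull c yl)).
  suff -> : (fun n => c ** y_ n) = (fun n => y_ n ** c) by exact: tends_amulr.
  apply/funext; elim=> [|n IH] /=; first by rewrite amul0l amul0r.
  by rewrite !amulE ch IH -amulA IH amulA.
- move=> p ph; apply: (tends_unique (tends_amull p yl)).
  suff -> : (fun n => p ** y_ n) = y_ by [].
  apply/funext; elim=> [|n IH] /=; first by rewrite amul0r.
  by rewrite !amulE ph IH.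
Qed.

End Root.

(** If [h ^ 2 + (1 - y) ^ 2 = 1] with commuting self-adjoint [h] and [1 - y]
    then [h + i (1 - y)] and its adjoint are unitary, and [h] is their mean.
    This bounds norms without any spectral theory. *)
Lemma unitary_mean_le1 h y : star h = h -> star y = y -> h ** y = y ** h ->
  h ** h = y + y - y ** y -> nr h <= 1.
Proof.
move=> h_sa y_sa hy hh.
have isom e x : e * e = -1 -> Num.conj e = - e ->
    nr (h ** x + e *: (x - y ** x)) = nr x.
  move=> ee ce; set w := (X in nr X = _).
  suff ew : star w ** w = star x ** x.
    by apply/eqP; rewrite -(@eqrXn2 _ 2) ?nrm_ge0 // -!nrm_cstar ew.
  have -> : star w ** w = star x ** x +
      star x ** (h ** h - (y + y - y ** y)) ** x +
      e *: (star x ** (y ** h - h ** y) ** x).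
    rewrite /w !(starD, starN, starM, starZ) h_sa y_sa ce.
    by star_identity R; ring: ee.
  by rewrite hh hy !subrr amul0r amul0l scaler0 !addr0.
have contr x : nr (h ** x) <= nr x.
  have := isom 'i x; have := isom (- 'i) x.
  rewrite rmorphN /= conjCi mulrNN -expr2 sqrCi => /(_ erefl erefl) e1 /(_ erefl erefl) e2.
  have : nr (h ** x + h ** x) <= nr x + nr x.
    rewrite -{1}e1 -e2; apply: le_trans (nrmD _ _); rewrite le_eqVlt; apply/orP; left.
    by apply/eqP; congr nr; star_identity R; ring.
  have -> : h ** x + h ** x = 2%:C *: (h ** x) by star_identity R; ring.
  by rewrite nrmZr ger0_norm //; lra.
have := contr h; rewrite nrm_sa //.
by have := nrm_ge0 h; have [//|h1] := leP (nr h) 1; nra.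
Qed.
End CStarTheory.

(** The equation says [(1 - y)^2 = 1 - h^2]: for [h] real between -1 and 1,
    [1 - y] would be the sine when [h] is the cosine. *)
Lemma exists_root_sqr (R : realType) (D : cstarAlgType R) (h : D) :
  star h = h -> nrm h <= 1 -> exists y, [/\ star y = y, nrm y <= 1,
    h ** h = y + y - y ** y,
    forall c, c ** h = h ** c -> c ** y = y ** c &
    forall p, p ** h = h -> p ** y = y].
Proof.
move=> h_sa h1.
have hh1 : nrm (h ** h) <= 1 by rewrite nrm_sa // expr_le1 ?nrm_ge0.
have [|y [y_sa y1 hy yc yp]] := exists_root _ hh1; first by rewrite starM h_sa.
exists y; split=> // [c ch|p ph]; [apply: yc|apply: yp].
  by rewrite amulA ch -amulA ch amulA.
by rewrite amulA ph.
Qed.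

(** The C*-identity turns the bound for self-adjoint elements into the bound
    for all elements. A self-adjoint [h] of norm at most 1 satisfies an
    equation [h ^ 2 = 2 y - y ^ 2] which is preserved by morphisms, and this
    equation alone bounds the norm of the image. *)
Lemma star_morphism_contractive (R : realType) (B D : cstarAlgType R)
    (psi : B -> D) : star_morphism psi -> forall x, nrm (psi x) <= nrm x.
Proof.
case=> psi_lin psiM psi_star.
pose psiL : {linear B -> D} := HB.pack psi
  (GRing.isLinear.Build R[i] B D *:%R psi psi_lin).
have psiD a b : psi (a + b) = psi a + psi b := linearD psiL a b.
have psiB a b : psi (a - b) = psi a - psi b := linearB psiL a b.
have psiZ k a : psi (k *: a) = k *: psi a := linearZ_LR psiL k a.
have psi0 : psi 0 = 0 := linear0 psiL.
have unit_ball h : star h = h -> nrm h <= 1 -> nrm (psi h) <= 1.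
  move=> h_sa h1; have [y [y_sa _ hy yc _]] := exists_root_sqr h_sa h1.
  apply: (@unitary_mean_le1 _ _ _ (psi y)).
  - by rewrite -psi_star h_sa.
  - by rewrite -psi_star y_sa.
  - by rewrite -!psiM yc.
  - by rewrite -!psiM hy psiB psiD.
have sa h : star h = h -> nrm (psi h) <= nrm h.
  move=> h_sa; have [h0|h0] := eqVneq (nrm h) 0.
    by rewrite (nrm0_eq0 h0) psi0 !nrm0.
  have hp : 0 < nrm h by rewrite lt_def h0 nrm_ge0.
  have /unit_ball : star ((nrm h)^-1%:C *: h) = (nrm h)^-1%:C *: h.
    by rewrite starZr h_sa.
  rewrite psiZ !nrmZr gtr0_norm ?invr_gt0 // mulVf // => /(_ (lexx _)).
  by rewrite ler_pdivrMl // mulr1.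
move=> x; rewrite -(@ler_pXn2r _ 2) ?nnegrE ?nrm_ge0 //.
rewrite -!nrm_cstar -psi_star -psiM; apply: sa.
by rewrite starM starK.
Qed.

(** * Positivity relative to a projection *)

Section Corner.
Variables (R : realType) (D : cstarAlgType R) (p : D).
Hypotheses (p_sa : star p = p) (pp : p ** p = p).
Implicit Types (a b c s x y z : D) (t : R).

Lemma corner_sa a : star a = a -> p ** a = a -> a ** p = a.
Proof. by move=> sa pa; rewrite -[LHS]starK starM p_sa sa pa sa. Qed.

(** Positivity in the unital C*-algebra [p D p]: the spectrum of [a] lies in
    the disc of centre [t] and radius [t]. This form makes stability under
    sums immediate. *)
Definition cpos a : Prop :=
  [/\ star a = a, p ** a = a & exists2 t, 0 <= t & nrm (t%:C *: p - a) <= t].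

Lemma cposD a b : cpos a -> cpos b -> cpos (a + b).
Proof.
move=> [a_sa pa [t t0 ta]] [b_sa pb [u u0 ub]]; split.
- by rewrite starD a_sa b_sa.
- by rewrite amulDr pa pb.
exists (t + u); first exact: addr_ge0.
have -> : (t + u)%:C *: p - (a + b) = (t%:C *: p - a) + (u%:C *: p - b).
  by star_identity R; ring.
exact: le_trans (nrmD _ _) (lerD ta ub).
Qed.

Lemma cposZ t a : 0 <= t -> cpos a -> cpos (t%:C *: a).
Proof.
move=> t0 [a_sa pa [u u0 ua]]; split.
- by rewrite starZr a_sa.
- by rewrite amulZr pa.
exists (t * u); first exact: mulr_ge0.
have -> : (t * u)%:C *: p - t%:C *: a = t%:C *: (u%:C *: p - a).
  by star_identity R; ring.
by rewrite nrmZr ger0_norm // ler_wpM2l.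
Qed.

Lemma cpos0 : cpos 0.
Proof.
by split; rewrite ?star0 ?amul0r //; exists 0; rewrite // scale0r subr0 nrm0.
Qed.

Lemma cpos_sum n (f : 'I_n -> D) : (forall i, cpos (f i)) -> cpos (\sum_i f i).
Proof. by move=> h; apply: big_ind => //; [exact: cpos0 | exact: cposD]. Qed.

Lemma cpos_sub_norm t a : star a = a -> p ** a = a -> nrm a <= t ->
  cpos (t%:C *: p - a).
Proof.
move=> a_sa pa ta; split.
- by rewrite starB starZr p_sa a_sa.
- by rewrite amulBr amulZr pp pa.
by exists t; [exact: le_trans (nrm_ge0 a) ta | rewrite opprB addrC subrK].
Qed.

(** [a / t] lies in the unit ball around [p], so [exists_root] applied to
    [p - a / t] gives its square root. *)
Lemma cpos_sqrt a : cpos a -> exists s, [/\ cpos s, s ** s = a &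
  forall c, c ** p = p ** c -> c ** a = a ** c -> c ** s = s ** c].
Proof.
move=> [a_sa pa [t t0 ta]]; have [t_eq0|t_neq0] := eqVneq t 0.
  exists 0; split; [exact: cpos0 | | by move=> c _ _; rewrite amul0l amul0r].
  rewrite amul0l; apply/esym/nrm0_eq0/le_anti; rewrite nrm_ge0 andbT.
  by move: ta; rewrite t_eq0 scale0r sub0r nrmN.
have tp : 0 < t by rewrite lt_def t_neq0.
have [||y [y_sa y1 hy yc yp]] := @exists_root _ _ (p - t^-1%:C *: a).
- by rewrite starB starZr p_sa a_sa.
- have -> : p - t^-1%:C *: a = t^-1%:C *: (t%:C *: p - a).
    by star_identity R; field; exact: realC_neq0.
  by rewrite nrmZr gtr0_norm ?invr_gt0 // ler_pdivrMl // mulr1.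
have {}yp : p ** y = y by apply: yp; rewrite amulBr amulZr pp pa.
have py := corner_sa y_sa yp.
pose r := Num.sqrt t; have r0 : 0 <= r := sqrtr_ge0 t.
have rr : r * r = t by rewrite -expr2 sqr_sqrtr.
exists (r%:C *: (p - y)); split.
- apply: cposZ => //; split; rewrite ?starB ?p_sa ?y_sa // ?amulBr ?pp ?yp //.
  by exists 1; rewrite // scale1r opprB addrC subrK.
- rewrite amulZl amulZr scalerA -rmorphM rr amulBl !amulBr pp yp py.
  have -> : p - y - (y - y ** y) = p - (y + y - y ** y).
    by star_identity R; ring.
  rewrite -hy; star_identity R; first by ring.
  by field; exact: realC_neq0.
- move=> c cp ca; rewrite amulZr amulZl amulBl amulBr cp yc //.
  by rewrite amulBl amulBr amulZl amulZr cp ca.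
Qed.

(** For [|r| <= 1] the element [p - r^2] is the square of some [p - y], and
    [p - y] together with [r] satisfies the hypotheses of [unitary_mean_le1], so
    that [|p - r^2| = |p - y|^2 <= 1]. *)
Lemma cpos_sqr s : star s = s -> p ** s = s -> cpos (s ** s).
Proof.
move=> s_sa ps; split; rewrite ?starM ?s_sa // ?amulA ?ps //.
have [s0|s0] := eqVneq (nrm s) 0.
  by exists 0; rewrite // (nrm0_eq0 s0) amul0l scale0r subr0 nrm0.
have sp : 0 < nrm s by rewrite lt_def s0 nrm_ge0.
pose r := (nrm s)^-1%:C *: s.
have r_sa : star r = r by rewrite starZr s_sa.
have r1 : nrm r <= 1 by rewrite nrmZr gtr0_norm ?invr_gt0 // mulVf.
have pr : p ** r = r by rewrite amulZr ps.
have rp := corner_sa r_sa pr.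
have [y [y_sa _ hy yc /(_ _ pr) yp]] := exists_root_sqr r_sa r1.
have py := corner_sa y_sa yp; have ry : r ** y = y ** r by rewrite yc.
have q1 : nrm (p - y) <= 1.
  apply: (@unitary_mean_le1 _ _ _ (p - r)); rewrite ?starB ?p_sa ?y_sa ?r_sa //.
    by rewrite !amulBl !amulBr pp rp pr yp py ry; star_identity R; ring.
  rewrite !amulBl !amulBr pp rp pr yp py hy; star_identity R; ring.
exists (nrm s ^+ 2); first exact: sqr_ge0.
have -> : (nrm s ^+ 2)%:C *: p - s ** s = (nrm s ^+ 2)%:C *: ((p - y) ** (p - y)).
  have -> : (p - y) ** (p - y) = p - r ** r.
    by rewrite hy !amulBl !amulBr pp yp py; star_identity R; ring.
  by rewrite /r; star_identity R; [ring | field; exact: realC_neq0].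
rewrite nrmZr ger0_norm ?sqr_ge0 // ler_piMr ?sqr_ge0 // nrm_sa.
  by rewrite expr_le1 ?nrm_ge0.
by rewrite starB p_sa y_sa.
Qed.

Lemma cpos_unit : cpos p. Proof. by rewrite -pp; exact: cpos_sqr. Qed.

Lemma cpos_comm a : cpos a -> a ** p = p ** a.
Proof. by move=> [a_sa pa _]; rewrite pa corner_sa. Qed.

(** The product of commuting roots is a self-adjoint root of the product. *)
Lemma cposM a b : cpos a -> cpos b -> a ** b = b ** a -> cpos (a ** b).
Proof.
move=> pos_a pos_b ab.
have [s [pos_s ss sc]] := cpos_sqrt pos_a; have [r [pos_r rr rc]] := cpos_sqrt pos_b.
have bs : b ** s = s ** b by rewrite sc // cpos_comm.
have sr : s ** r = r ** s by rewrite rc // cpos_comm.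
have -> : a ** b = (s ** r) ** (s ** r).
  by rewrite {2}sr amulA -[s ** r ** r]amulA rr -[RHS]amulA bs amulA ss.
case: pos_s pos_r => [s_sa ps _] [r_sa pr _].
by apply: cpos_sqr; rewrite ?starM ?s_sa ?r_sa ?sr // -sr amulA ps.
Qed.

(** After scaling to [t = 1]: [p + a] and [p - a] have commuting roots [s] and
    [r], so [(s r)^2 = p - a^2] and [a + i s r] is unitary. *)
Lemma cpos_between t a : 0 <= t -> cpos (t%:C *: p + a) -> cpos (t%:C *: p - a) ->
  nrm a <= t.
Proof.
wlog tp : t / 0 < t => [hw|_].
  move=> t0 h1 h2; apply: (@le_all_eps _ _ _ 1) => // e e0; rewrite mul1r.
  by apply: hw; rewrite ?ltr_wpDl // ?addr_ge0 ?(ltW e0) // rmorphD scalerDl addrAC;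
     apply: cposD => //; apply: cposZ (ltW e0) cpos_unit.
move=> posD posB; pose b := t^-1%:C *: a.
have tn : t%:C != 0 :> R[i] by apply: realC_neq0; rewrite gt_eqF.
have ti : 0 <= t^-1 by rewrite invr_ge0 ltW.
have {}posD : cpos (p + b).
  have -> : p + b = t^-1%:C *: (t%:C *: p + a) by rewrite /b; star_identity R; field.
  exact: cposZ.
have {}posB : cpos (p - b).
  have -> : p - b = t^-1%:C *: (t%:C *: p - a) by rewrite /b; star_identity R; field.
  exact: cposZ.
suff : nrm b <= 1.
  by rewrite /b nrmZr ger0_norm // ler_pdivrMl // mulr1.
have [[_ pD _] [_ pB _]] := (posD, posB).
have pb : p ** b = b by apply: (addrI p); rewrite -{1}pp -amulDr pD.
have b_sa : star b = b.
  by case: posD => + _ _; rewrite starD p_sa => /addrI.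
have bp := corner_sa b_sa pb.
have DB : (p - b) ** (p + b) = (p + b) ** (p - b).
  by rewrite !amulBl !amulDl !amulBr !amulDr pp pb bp; star_identity R; ring.
have [s [pos_s ss sc]] := cpos_sqrt posD; have [r [pos_r rr rc]] := cpos_sqrt posB.
have Bs : (p - b) ** s = s ** (p - b) by rewrite sc // cpos_comm.
have sr : s ** r = r ** s by rewrite rc // cpos_comm.
have [[s_sa ps _] [r_sa pr _]] := (pos_s, pos_r).
have rp := corner_sa r_sa pr.
have bs : b ** s = s ** b.
  apply: oppr_inj; apply: (addrI s).
  by rewrite -{1}ps -amulBl Bs amulBr (corner_sa s_sa ps).
have br : b ** r = r ** b.
  apply: rc; first by rewrite bp pb.
  by rewrite amulBl amulBr bp pb.
have srp : s ** r ** p = s ** r by rewrite -amulA rp.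
have psr : p ** (s ** r) = s ** r by rewrite amulA ps.
have srsr : s ** r ** (s ** r) = p - b ** b.
  rewrite {2}sr amulA -[s ** r ** r]amulA rr -amulA Bs amulA ss.
  by rewrite !amulDl !amulBr pp pb bp; star_identity R; ring.
apply: (@unitary_mean_le1 _ _ _ (p - s ** r)) => //.
- by rewrite starB p_sa starM s_sa r_sa -sr.
- by rewrite amulBl amulBr bp pb amulA bs -amulA br amulA.
- by rewrite !amulBl !amulBr pp srp psr srsr; star_identity R; ring.
Qed.

(** [|b| p - a = (|b| p - b) + (b - a)] is positive, as is [|b| p + a]. *)
Lemma cpos_norm_mono a b : cpos a -> cpos (b - a) -> nrm a <= nrm b.
Proof.
move=> pos_a pos_ba; have pos_b : cpos b by rewrite -(subrK a b); exact: cposD.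
have [b_sa pb _] := pos_b.
apply: cpos_between; rewrite ?nrm_ge0 //.
  by apply: cposD => //; apply: cposZ cpos_unit; exact: nrm_ge0.
have -> : (nrm b)%:C *: p - a = ((nrm b)%:C *: p - b) + (b - a) by rewrite addrA subrK.
by apply: cposD => //; exact: cpos_sub_norm.
Qed.

(** Put [u = - z^* z], [v = z z^*] and [l = |z|^2], the norm of both. Since
    [v - u] is twice a sum of two squares, by the real and imaginary parts of
    [z], [v] is positive and [|l - v| <= l]. Now [l u + u^2 = - z^* (l - v) z]
    has norm at most [l^2], whereas [l u + u^2 >= 2 u^2] has norm at least
    [2 l^2]; hence [l = 0]. This replaces the equality of the spectra of
    [z^* z] and [z z^*]. *)
Lemma neg_star_mul_eq0 z : p ** z = z -> z ** p = z ->
  cpos (- (star z ** z)) -> z = 0.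
Proof.
move=> pz zp pos_u; pose u := - (star z ** z).
pose v := z ** star z; pose l := nrm z ^+ 2.
have l0 : 0 <= l := sqr_ge0 _.
have pzs : p ** star z = star z by rewrite -{1}p_sa -starM zp.
have zsp : star z ** p = star z by rewrite -{1}p_sa -starM pz.
have v_sa : star v = v by rewrite starM starK.
have pv : p ** v = v by rewrite amulA pz.
have nv : nrm v = l by rewrite /v -{1}(starK z) nrm_cstar nrm_star.
have [u_sa pu _] := pos_u; rewrite -/u in u_sa pu.
have up := corner_sa u_sa pu.
have nu : nrm u = l by rewrite nrmN nrm_cstar.
have pos_v : cpos v.
  pose b := z + star z; pose c := 'i *: (z - star z).
  have -> : v = u + (2^-1)%:C *: (b ** b + c ** c).
    rewrite /b /c /u /v; star_identity R; by field: (@sqrCi R[i]).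
  apply: cposD => //; apply: cposZ; first by rewrite invr_ge0.
  apply: cposD; apply: cpos_sqr.
  - by rewrite starD starK addrC.
  - by rewrite amulDr pz pzs.
  - by rewrite /c; star_identity R; ring.
  - by rewrite amulZr amulBr pz pzs.
(* [- l p <= l p - v <= l p] because [0 <= v] and [|v| = l]. *)
have lv : nrm (l%:C *: p - v) <= l.
  apply: cpos_between => //.
    have -> : l%:C *: p + (l%:C *: p - v) = (l + l)%:C *: p - v.
      by star_identity R; ring.
    by apply: cpos_sub_norm => //; rewrite nv lerDl.
  by rewrite opprB addrC subrK.
have le1 : nrm (l%:C *: u + u ** u) <= l * l.
  have -> : l%:C *: u + u ** u = - (star z ** (l%:C *: p - v) ** z).
    rewrite amulBr amulBl amulZr amulZl zsp /u /v.
    by star_identity R; ring.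
  rewrite nrmN; apply: le_trans (nrm_amul _ _) _.
  apply: le_trans (ler_wpM2r (nrm_ge0 _) (nrm_amul _ _)) _.
  rewrite nrm_star mulrAC -expr2; exact: ler_wpM2l.
have le2 : nrm (2%:C *: (u ** u)) <= nrm (l%:C *: u + u ** u).
  apply: cpos_norm_mono.
    by apply: cposZ => //; exact: cpos_sqr.
  have -> : l%:C *: u + u ** u - 2%:C *: (u ** u) = u ** (l%:C *: p - u).
    by rewrite amulBr amulZr up; star_identity R; ring.
  apply: cposM => //; first by apply: cpos_sub_norm => //; rewrite nu.
  by rewrite amulBr amulBl amulZr amulZl up pu.
move: le2; rewrite nrmZr ger0_norm // nrm_sa // nu => le2.
apply: nrm0_eq0; apply/eqP; rewrite -sqrf_eq0 -/l.
by rewrite -sqrf_eq0; apply/eqP/le_anti; rewrite sqr_ge0 andbT; nra.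
Qed.

(** Kaplansky's argument: with [h = x^* x], [k = |h|] and [m = k - h], the
    element [z = x m] has [z^* z = m h m = - m k m], the opposite of a square,
    so [z = 0]. Then [k m = 0], which forces [m^2 = 0] and [h = k]. *)
Lemma cpos_star_mul x : p ** x = x -> x ** p = x -> cpos (star x ** x).
Proof.
move=> px xp; pose h := star x ** x.
have h_sa : star h = h by rewrite starM starK.
have ph : p ** h = h by rewrite amulA -{1}p_sa -starM xp.
have hp := corner_sa h_sa ph.
have [k [pos_k kk kc]] := cpos_sqrt (cpos_sqr h_sa ph).
have [k_sa pk _] := pos_k; have kp := corner_sa k_sa pk.
have [s [pos_s ss sc]] := cpos_sqrt pos_k.
have [s_sa ps _] := pos_s; have sp := corner_sa s_sa ps.
have hk : h ** k = k ** h by apply: kc; rewrite ?hp ?ph ?amulA.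
have hs : h ** s = s ** h by apply: sc; rewrite ?hp ?ph.
pose m := k - h.
have m_sa : star m = m by rewrite starB k_sa h_sa.
have pm : p ** m = m by rewrite amulBr pk ph.
have mp := corner_sa m_sa pm.
have sk : k ** s = s ** k by rewrite -ss amulA.
have sm : s ** m = m ** s by rewrite amulBl amulBr hs sk.
have hm : h ** m = - (k ** m).
  by rewrite !amulBr kk hk; star_identity R; ring.
have zz : star (x ** m) ** (x ** m) = - ((s ** m) ** (s ** m)).
  rewrite starM m_sa amulA -[m ** star x ** x]amulA -/h -amulA hm -ss.
  by rewrite amulNr -[s ** s ** m]amulA [in LHS]amulA -sm.
have pos_sm : cpos ((s ** m) ** (s ** m)).
  by apply: cpos_sqr; rewrite ?starM ?s_sa ?m_sa ?sm // -sm amulA ps.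
have z0 : x ** m = 0.
  apply: neg_star_mul_eq0; first by rewrite amulA px.
    by rewrite -amulA mp.
  by rewrite zz opprK.
have sm0 : s ** m = 0.
  apply: sa_sqr_eq0; first by rewrite starM s_sa m_sa sm.
  by apply: oppr_inj; rewrite -zz z0 amul0r oppr0.
have km0 : k ** m = 0 by rewrite -ss -amulA sm0 amul0r.
have m0 : m = 0.
  apply: sa_sqr_eq0 => //.
  by rewrite {1}/m amulBl hm km0 oppr0 subrr.
by rewrite -/h -(_ : k = h) //; apply/eqP; rewrite -subr_eq0; apply/eqP.
Qed.

End Corner.

(** The unit of [A] is sent to a projection [p], and a morphism on [A] takes its
    values in the corner of [p], where sums of squares are positive. *)
Lemma star_morphism_sqr_bound (R : realType) (A : unitalStarAlgType R)
    (D : cstarAlgType R) (phi : A -> D) : star_morphism phi ->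
  forall (r : R) (x : A), 0 <= r -> apos A (r%:C *: aone - star x ** x) ->
  nrm (phi x) ^+ 2 <= r.
Proof.
case=> phi_lin phiM phi_star r x r0 [n [b eb]].
pose phiL : {linear A -> D} := HB.pack phi
  (GRing.isLinear.Build R[i] A D *:%R phi phi_lin).
have phiB u v : phi (u - v) = phi u - phi v := linearB phiL u v.
have phiZ k u : phi (k *: u) = k *: phi u := linearZ_LR phiL k u.
have phi_sum m (f : 'I_m -> A) : phi (\sum_i f i) = \sum_i phi (f i) :=
  linear_sum phiL _ _ _.
pose p := phi aone.
have pL a : p ** phi a = phi a by rewrite -phiM amul1a.
have pR a : phi a ** p = phi a by rewrite -phiM amula1.
have pp : p ** p = p by exact: pL.
have p_sa : star p = p by rewrite -phi_star star1.
have pos_sq a : cpos p (star (phi a) ** phi a) by exact: cpos_star_mul.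
rewrite -nrm_cstar; apply: (cpos_between p_sa pp r0).
  apply: cposD => //; apply: cposZ => //; exact: cpos_unit.
rewrite -phi_star -phiM -phiZ -phiB eb phi_sum; apply: cpos_sum => // i.
by rewrite phiM phi_star.
Qed.

(** * The algebraic seminorm *)

Lemma le_of_all_gt (R : realType) (a b : R) : (forall r, b < r -> a <= r) -> a <= b.
Proof.
move=> h; apply: (@le_all_eps _ _ _ 1) => // e e0; apply: h.
by rewrite mul1r ltrDl.
Qed.

Lemma le_mul_of_all_gt (R : realType) (a b c : R) : 0 <= b -> 0 <= c ->
  (forall r s, b < r -> c < s -> a <= r * s) -> a <= b * c.
Proof.
move=> b0 c0 h; apply: (@le_all_eps _ _ _ (b + c + 1)); first lra.
move=> e e0; have [e1|/ltW e1] := leP e 1.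
  by have := h (b + e) (c + e); rewrite !ltrDl e0 => /(_ isT isT); nra.
have := h (b + 1) (c + 1); rewrite !ltrDl ltr01 => /(_ isT isT); nra.
Qed.

Section AlgebraicSeminorm.
Variables (R : realType) (A : unitalStarAlgType R).
Local Notation e := (aone : A).
Local Notation pos := (apos A).
Implicit Types (a b x y : A) (r s t : R).

Ltac unital_identity :=
  rewrite ?starE ?star1 ?amulE ?amul1a ?amula1; linear_identity_over constr:(R[i]).

Lemma apos_star_mul x : pos (star x ** x).
Proof. by exists 0%N, (fun=> x); rewrite big_ord1. Qed.

Lemma apos_sqr a : star a = a -> pos (a ** a).
Proof. by move=> {1}<-; exact: apos_star_mul. Qed.

Lemma apos0 : pos 0.
Proof. by have := apos_star_mul 0; rewrite amul0r. Qed.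

Lemma aposD a b : pos a -> pos b -> pos (a + b).
Proof.
move=> [n [f ->]] [m [g ->]].
exists (n + m.+1)%N, (fun i : 'I_(n.+1 + m.+1) =>
  match fintype.split i with inl j => f j | inr j => g j end).
rewrite -[(n + m.+1).+1]/(n.+1 + m.+1)%N big_split_ord /=.
by congr (_ + _); apply: eq_bigr => i _; rewrite ?(unsplitK (inl i)) ?(unsplitK (inr i)).
Qed.

Lemma apos_conj y a : pos a -> pos (star y ** a ** y).
Proof.
move=> [n [f ->]]; exists n, (fun i => f i ** y).
rewrite amul_sumr amul_suml; apply: eq_bigr => i _.
by rewrite starM !amulA.
Qed.

Lemma aposZ r a : 0 <= r -> pos a -> pos (r%:C *: a).
Proof.
move=> r0 [n [f ->]]; exists n, (fun i => (Num.sqrt r)%:C *: f i).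
rewrite scaler_sumr; apply: eq_bigr => i _.
by rewrite starZr amulZl amulZr scalerA -rmorphM -expr2 sqr_sqrtr.
Qed.

Lemma apos_scalar r : 0 <= r -> pos (r%:C *: e).
Proof. by move=> r0; apply: aposZ => //; rewrite -[e]amul1a; apply: apos_sqr; exact: star1. Qed.

Lemma apos_scalar_le r s a : r <= s -> pos (r%:C *: e + a) -> pos (s%:C *: e + a).
Proof.
move=> rs pa; rewrite (_ : _ + a = (s - r)%:C *: e + (r%:C *: e + a)).
  by apply: aposD => //; apply: apos_scalar; rewrite subr_ge0.
by star_identity R; ring.
Qed.

Lemma norm_sa_ge0 a : 0 <= norm_sa a.
Proof.
rewrite /norm_sa; set S := (X in inf X).
have [->|/set0P S0] := eqVneq S set0; first by rewrite inf0.
by apply: lb_le_inf => // r [/ltW].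
Qed.

Lemma norm_sa_le r a : 0 < r -> pos (r%:C *: e + a) -> pos (r%:C *: e - a) ->
  norm_sa a <= r.
Proof.
move=> r0 h1 h2; apply: ge_inf; last by split.
by exists 0 => s [/ltW].
Qed.

Lemma anorm_ge0 x : 0 <= anorm x. Proof. exact: sqrtr_ge0. Qed.

Lemma anorm_sqr x : anorm x ^+ 2 = norm_sa (star x ** x).
Proof. by rewrite sqr_sqrtr // norm_sa_ge0. Qed.

(** [r^2 + x^* x] is always positive, so [r^2 - x^* x] alone constrains the
    norm. *)
Lemma anorm_le r x : 0 < r -> pos ((r ^+ 2)%:C *: e - star x ** x) -> anorm x <= r.
Proof.
move=> r0 h; rewrite -(@ler_pXn2r _ 2) ?nnegrE ?anorm_ge0 ?(ltW r0) // anorm_sqr.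
apply: norm_sa_le => //; first by rewrite exprn_gt0.
apply: aposD; [apply: apos_scalar; exact: sqr_ge0 | exact: apos_star_mul].
Qed.

Section Bounded.
Hypothesis hA : bounded_algebra A.

(** The decomposition of a self-adjoint element into real and imaginary parts
    is trivial, so boundedness of the algebra applies to the element itself. *)
Lemma sa_bounded a : star a = a -> exists2 r, 0 < r &
  pos (r%:C *: e + a) /\ pos (r%:C *: e - a).
Proof.
move=> a_sa; have [b [c [b_sa c_sa ea [r [r0 h1 h2]] _]]] := hA a.
have ab : a = b.
  have c2 : 'i *: c = - 'i *: c.
    apply: (addrI b); rewrite -ea -[LHS]a_sa ea starD starZi.
    by rewrite [star b]b_sa [star c]c_sa.
  have i2 : 'i *: c = 0.
    have : 'i *: c + 'i *: c = 0 by rewrite {1}c2 scaleNr addNr.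
    move=> /eqP; rewrite -mulr2n -scaler_nat scaler_eq0 pnatr_eq0 /=.
    by move/eqP.
  by rewrite ea i2 addr0.
rewrite ab; exists (r + 1); first by lra.
split; apply: (@apos_scalar_le r); rewrite ?lerDl //.
by move: h2; rewrite /age opprK addrC.
Qed.

Lemma norm_sa_lt r a : star a = a -> norm_sa a < r ->
  pos (r%:C *: e + a) /\ pos (r%:C *: e - a).
Proof.
move=> a_sa.
have hi : has_inf [set r | [/\ 0 < r, pos (r%:C *: e + a) & pos (r%:C *: e - a)]].
  split; last by exists 0 => s [/ltW].
  by have [s s0 [h1 h2]] := sa_bounded a_sa; exists s.
move=> ar; have [|s [s0 h1 h2]] := @inf_adherent _ _ (r - norm_sa a) _ hi.
  by rewrite subr_gt0.
rewrite -/(norm_sa a) addrC subrK => /ltW sr.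
by split; exact: apos_scalar_le sr _.
Qed.

Lemma anorm_lt r x : anorm x < r -> pos ((r ^+ 2)%:C *: e - star x ** x).
Proof.
move=> xr; apply: (norm_sa_lt _ _).2; first by rewrite starM starK.
by rewrite -anorm_sqr ltr_pXn2r ?nnegrE ?anorm_ge0 // ltW // (le_lt_trans (anorm_ge0 x)).
Qed.

(** In both directions the positivity of one side is written with squares and
    conjugates of the other: [2 r (r + a) = (r + a)^2 + (r^2 - a^2)] and
    [2 r (r^2 - a^2) = (r - a)(r + a)(r - a) + (r + a)(r - a)(r + a)]. *)
Lemma norm_sa_anorm a : star a = a -> norm_sa a = anorm a.
Proof.
move=> a_sa; apply/le_anti/andP; split; apply: le_of_all_gt => r lt_r.
  have r0 : 0 < r := le_lt_trans (anorm_ge0 _) lt_r.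
  have h := anorm_lt lt_r; rewrite a_sa in h.
  have half : 0 <= (2 * r)^-1 by rewrite invr_ge0; lra.
  have rn : r%:C != 0 :> R[i] by apply: realC_neq0; rewrite gt_eqF.
  apply: norm_sa_le => //.
    have -> : r%:C *: e + a = (2 * r)^-1%:C *:
        ((r%:C *: e + a) ** (r%:C *: e + a) + ((r ^+ 2)%:C *: e - a ** a)).
      by unital_identity; field.
    apply: aposZ => //; apply: aposD => //; apply: apos_sqr.
    by rewrite starD starZr star1 a_sa.
  have -> : r%:C *: e - a = (2 * r)^-1%:C *:
      ((r%:C *: e - a) ** (r%:C *: e - a) + ((r ^+ 2)%:C *: e - a ** a)).
    by unital_identity; field.
  apply: aposZ => //; apply: aposD => //; apply: apos_sqr.
  by rewrite starB starZr star1 a_sa.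
have r0 : 0 < r := le_lt_trans (norm_sa_ge0 _) lt_r.
have half : 0 <= (2 * r)^-1 by rewrite invr_ge0; lra.
have rn : r%:C != 0 :> R[i] by apply: realC_neq0; rewrite gt_eqF.
have [hD hB] := norm_sa_lt a_sa lt_r.
have D_sa : star (r%:C *: e + a) = r%:C *: e + a by rewrite starD starZr star1 a_sa.
have B_sa : star (r%:C *: e - a) = r%:C *: e - a by rewrite starB starZr star1 a_sa.
have := aposD (apos_conj (r%:C *: e - a) hD) (apos_conj (r%:C *: e + a) hB).
rewrite D_sa B_sa => /(aposZ half) h; apply: anorm_le => //.
rewrite a_sa; move: h; set w := (X in apos A X) => h.
suff -> : (r ^+ 2)%:C *: e - a ** a = w by [].
by rewrite /w; unital_identity; field.
Qed.

Lemma anorm_star_mul x : anorm (star x ** x) = anorm x ^+ 2.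
Proof. by rewrite -norm_sa_anorm ?anorm_sqr // starM starK. Qed.

(** [r^2 (r^2 - x x^* )] is [(r^2 - x x^* )^2 + x (r^2 - x^* x) x^*]. *)
Lemma anorm_star_le x : anorm (star x) <= anorm x.
Proof.
apply: le_of_all_gt => r lt_r; have r0 : 0 < r := le_lt_trans (anorm_ge0 _) lt_r.
have h := anorm_lt lt_r; apply: anorm_le => //; rewrite starK.
have rn : r%:C != 0 :> R[i] by apply: realC_neq0; rewrite gt_eqF.
have -> : (r ^+ 2)%:C *: e - x ** star x = (r ^- 2)%:C *:
    (((r ^+ 2)%:C *: e - x ** star x) ** ((r ^+ 2)%:C *: e - x ** star x) +
     star (star x) ** ((r ^+ 2)%:C *: e - star x ** x) ** star x).
  by unital_identity; field.
apply: aposZ; first by rewrite invr_ge0 sqr_ge0.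
apply: aposD; last exact: apos_conj.
by apply: apos_sqr; rewrite starB starZr star1 starM starK.
Qed.

Lemma anorm_star x : anorm (star x) = anorm x.
Proof.
apply/le_anti; rewrite anorm_star_le /=.
by have := anorm_star_le (star x); rewrite starK.
Qed.

(** [r^2 s^2 - |x y|^2 = y^* (r^2 - |x|^2) y + r^2 (s^2 - |y|^2)], where
    [|x|^2] stands for [x^* x]. *)
Lemma anormM x y : anorm (x ** y) <= anorm x * anorm y.
Proof.
apply: le_mul_of_all_gt; rewrite ?anorm_ge0 // => r s xr ys.
have r0 : 0 < r := le_lt_trans (anorm_ge0 _) xr.
have s0 : 0 < s := le_lt_trans (anorm_ge0 _) ys.
apply: anorm_le; first exact: mulr_gt0.
have -> : ((r * s) ^+ 2)%:C *: e - star (x ** y) ** (x ** y) =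
    star y ** ((r ^+ 2)%:C *: e - star x ** x) ** y +
    (r ^+ 2)%:C *: ((s ^+ 2)%:C *: e - star y ** y).
  by unital_identity; ring.
apply: aposD; first by apply: apos_conj; exact: anorm_lt.
by apply: aposZ; [exact: sqr_ge0 | exact: anorm_lt].
Qed.

(** Writing [|x|^2] for [x^* x], the element [(r + s)^2 - |x + y|^2] is a
    combination of [r^2 - |x|^2] and [s^2 - |y|^2] with positive coefficients,
    plus the square [|s x - r y|^2 / (r s)]. *)
Lemma anormD x y : anorm (x + y) <= anorm x + anorm y.
Proof.
have step r s : anorm x < r -> anorm y < s -> anorm (x + y) <= r + s.
  move=> xr ys.
  have r0 : 0 < r := le_lt_trans (anorm_ge0 _) xr.
  have s0 : 0 < s := le_lt_trans (anorm_ge0 _) ys.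
  have rn : r%:C != 0 :> R[i] by apply: realC_neq0; rewrite gt_eqF.
  have sn : s%:C != 0 :> R[i] by apply: realC_neq0; rewrite gt_eqF.
  apply: anorm_le; first exact: addr_gt0.
  pose z := s%:C *: x - r%:C *: y.
  have -> : ((r + s) ^+ 2)%:C *: e - star (x + y) ** (x + y) =
      ((r + s) / r)%:C *: ((r ^+ 2)%:C *: e - star x ** x) +
      ((r + s) / s)%:C *: ((s ^+ 2)%:C *: e - star y ** y) +
      ((r * s)^-1)%:C *: (star z ** z).
    by rewrite /z; unital_identity; field; rewrite ?rn ?sn.
  apply: aposD; last by apply: aposZ (apos_star_mul _); rewrite invr_ge0 mulr_ge0 ?ltW.
  by apply: aposD; apply: aposZ; rewrite ?divr_ge0 ?addr_ge0 ?ltW //; exact: anorm_lt.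
apply: (@le_all_eps _ _ _ 2) => // d d0.
have := step (anorm x + d) (anorm y + d); rewrite !ltrDl d0 => /(_ isT isT); lra.
Qed.

Lemma anormZ (k : R[i]) x : anorm (k *: x) = nrm k * anorm x.
Proof.
have le l y : anorm (l *: y) <= nrm l * anorm y.
  apply: le_mul_of_all_gt; rewrite ?anorm_ge0 //; first by rewrite -lecR -normE normr_ge0.
  move=> r s lr ys; have l0 : 0 <= nrm l by rewrite -lecR -normE normr_ge0.
  have r0 : 0 < r := le_lt_trans l0 lr.
  have s0 : 0 < s := le_lt_trans (anorm_ge0 _) ys.
  apply: anorm_le; first exact: mulr_gt0.
  have -> : ((r * s) ^+ 2)%:C *: e - star (l *: y) ** (l *: y) =
      (r ^+ 2 * s ^+ 2 - nrm l ^+ 2 * s ^+ 2)%:C *: e +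
      (nrm l ^+ 2)%:C *: ((s ^+ 2)%:C *: e - star y ** y).
    have cl : Num.conj l * l = (nrm l ^+ 2)%:C.
      by rewrite rmorphXn /= -normE mulrC -normCK.
    rewrite starZ amulZl amulZr [_ *: (_ *: _)]scalerA cl.
    by star_identity R; ring.
  apply: aposD.
    apply: apos_scalar; rewrite subr_ge0 ler_wpM2r ?sqr_ge0 //.
    by rewrite ler_pXn2r ?nnegrE // ltW.
  by apply: aposZ; [exact: sqr_ge0 | exact: anorm_lt].
have [->|k0] := eqVneq k 0.
  have n0 : nrm (0 : R[i]) = 0 by rewrite /nrm normr0.
  by have := le 0 x; rewrite n0 !mul0r => h; apply/le_anti; rewrite h anorm_ge0.
apply/le_anti; rewrite le /=; have := le k^-1 (k *: x).
rewrite scalerA mulVf // scale1r.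
have -> : nrm k^-1 = (nrm k)^-1.
  by apply/complexI; rewrite fmorphV /= -!normE normfV.
rewrite ler_pdivlMl //.
rewrite lt_def; apply/andP; split; last by rewrite -lecR -normE normr_ge0.
by apply: contra_neq k0 => h; apply/eqP; rewrite -normr_eq0 normE h.
Qed.

Lemma anorm_eq0P x : anorm x = 0 <-> forall d, 0 < d ->
  pos (d%:C *: e - star x ** x).
Proof.
split=> [x0 d d0|h].
  rewrite -[d]sqr_sqrtr ?ltW //; apply: anorm_lt.
  by rewrite x0 sqrtr_gt0.
apply/le_anti; rewrite anorm_ge0 andbT; apply: le_of_all_gt => r r0.
by apply: anorm_le => //; apply: h; rewrite exprn_gt0.
Qed.

End Bounded.
End AlgebraicSeminorm.

(** * Completion of a seminormed space *)

Section Tends.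
Variable R : realType.

Lemma tends_cvg0 (V : zmodType) (N : V -> R) u l : (forall x, 0 <= N x) ->
  tends N u l <-> (fun n => N (u n - l)) @ \oo --> (0 : R).
Proof.
move=> N0; split=> [h|/cvgrPdist_lt h] => [|e e0].
  apply/cvgrPdist_lt => e /h[n0 hn]; exists n0 => // n /hn.
  by rewrite sub0r normrN ger0_norm.
have [n0 _ hn] := h e e0; exists n0 => n /hn /=.
by rewrite sub0r normrN ger0_norm.
Qed.

Lemma tends_realP (u : nat -> R) l : tends (@Num.norm R R) u l <-> u @ \oo --> l.
Proof.
rewrite tends_cvg0; last by move=> x; exact: normr_ge0.
split=> [h|h]; last first.
  rewrite -[0 in X in _ --> X](normr0 R) -(subrr l); apply: cvg_norm.
  by apply: cvgB => //; exact: cvg_cst.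
apply/cvgrPdist_lt => e e0; have /cvgrPdist_lt/(_ e e0)[n0 _ hn] := h.
by exists n0 => // n /hn /=; rewrite sub0r normrN normr_id distrC.
Qed.

Variable V : normedModType R[i].
Local Notation nr := (@nrm R V).
Implicit Types (u v : nat -> V) (x y : V).

Lemma tends_cvg u x : tends nr u x <-> (fun n => nr (u n - x)) @ \oo --> (0 : R).
Proof. by apply: tends_cvg0 => z; exact: nrm_ge0. Qed.

Lemma tends_squeeze u x (b : nat -> R) : (forall n, nr (u n - x) <= b n) ->
  b @ \oo --> (0 : R) -> tends nr u x.
Proof.
move=> ub b0; apply/tends_cvg; apply: squeeze_cvgr (cvg_cst 0) b0.
by near=> n; rewrite nrm_ge0 ub.
Unshelve. all: by end_near. Qed.

Lemma tends_cst x : tends nr (fun=> x) x.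
Proof. by move=> e e0; exists 0%N => n _; rewrite subrr nrm0. Qed.

Lemma tendsD u v x y : tends nr u x -> tends nr v y ->
  tends nr (fun n => u n + v n) (x + y).
Proof.
move=> /tends_cvg ux /tends_cvg vy.
apply: (@tends_squeeze _ _ (fun n => nr (u n - x) + nr (v n - y))).
  by move=> n; rewrite opprD addrACA nrmD.
by rewrite -[0 in X in _ --> X](addr0 0); exact: cvgD.
Qed.

Lemma tendsZ k u x : tends nr u x -> tends nr (fun n => k *: u n) (k *: x).
Proof.
move=> /tends_cvg ux; apply: (@tends_squeeze _ _ (fun n => nrm k * nr (u n - x))).
  by move=> n; rewrite -scalerBr nrmZ.
by rewrite -[0 in X in _ --> X](mulr0 (nrm k)); apply: cvgM => //; exact: cvg_cst.
Qed.

Lemma tendsN u x : tends nr u x -> tends nr (fun n => - u n) (- x).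
Proof.
move=> h e /h[n0 hn]; exists n0 => n /hn.
by rewrite -opprD nrmN.
Qed.

Lemma tendsB u v x y : tends nr u x -> tends nr v y ->
  tends nr (fun n => u n - v n) (x - y).
Proof. by move=> ux vy; apply: tendsD ux (tendsN vy). Qed.

Lemma tends_nrm u x : tends nr u x -> (fun n => nr (u n)) @ \oo --> nr x.
Proof.
move=> ux; apply/tends_realP => e /ux[n0 hn]; exists n0 => n /hn.
apply: le_lt_trans; rewrite ler_norml nrm_sub_le andbT.
by rewrite lerNl opprB nrmBC nrm_sub_le.
Qed.

Lemma tends_cauchy u x : tends nr u x -> cauchy_wrt nr u.
Proof.
move=> ux e e0; have [|n0 hn] := ux (e / 2); first by rewrite divr_gt0.
exists n0 => m n /hn hm /hn hn'; apply: le_lt_trans (nrm_triangle x _ _) _.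
by rewrite (nrmBC x); lra.
Qed.

End Tends.

Record seminorm (R : realType) (V : lmodType R[i]) := Seminorm {
  semi :> V -> R ;
  semiD : forall x y, semi (x + y) <= semi x + semi y ;
  semiZ : forall k x, semi (k *: x) = nrm k * semi x
}.

Section SeminormTheory.
Variables (R : realType) (V : lmodType R[i]) (N : seminorm V).

Lemma semi0 : N 0 = 0.
Proof. by rewrite -(scale0r 0) semiZ /nrm normr0 mul0r. Qed.

Lemma semiN x : N (- x) = N x.
Proof. by rewrite -scaleN1r semiZ /nrm normrN1 mul1r. Qed.

Lemma semi_ge0 x : 0 <= N x.
Proof.
have := semiD N x (- x); rewrite subrr semi0 semiN; lra.
Qed.

Lemma semiBC x y : N (x - y) = N (y - x).
Proof. by rewrite -semiN opprB. Qed.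

Lemma semi_triangle y x z : N (x - z) <= N (x - y) + N (y - z).
Proof. by rewrite -[x - z](subrKA y) semiD. Qed.

Lemma semi_sub_le x y : N x - N y <= N (x - y).
Proof. by rewrite lerBlDr -{1}(subrK y x) semiD. Qed.

Lemma cauchy_semi_cvg u : cauchy_wrt N u -> cvg ((fun n => N (u n)) @ \oo).
Proof.
move=> cu; have [|l /tends_realP h] := @real_complete R (fun n => N (u n)).
  move=> e /cu[n0 hn]; exists n0 => m n hm hn'.
  apply: le_lt_trans (hn m n hm hn'); rewrite ler_norml semi_sub_le andbT.
  by rewrite lerNl opprB semiBC semi_sub_le.
by apply/cvg_ex; exists l.
Qed.

Lemma cauchy_wrt_cst x : cauchy_wrt N (fun=> x).
Proof. by move=> e e0; exists 0%N => m n _ _; rewrite subrr semi0. Qed.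

Lemma cauchy_wrtD u v : cauchy_wrt N u -> cauchy_wrt N v -> cauchy_wrt N (u \+ v).
Proof.
move=> cu cv e e0; have e2 : 0 < e / 2 by rewrite divr_gt0.
have [n1 h1] := cu _ e2; have [n2 h2] := cv _ e2.
exists (maxn n1 n2) => m n; rewrite !geq_max => /andP[m1 m2] /andP[k1 k2] /=.
rewrite opprD addrACA; apply: le_lt_trans (semiD _ _ _) _.
by have := h1 m n m1 k1; have := h2 m n m2 k2; lra.
Qed.

Lemma cauchy_wrtZ k u : cauchy_wrt N u -> cauchy_wrt N (fun n => k *: u n).
Proof.
move=> cu e e0; have k0 : 0 <= nrm k by rewrite -lecR -normE normr_ge0.
have k1 : 0 < nrm k + 1 by lra.
have [|n0 hn] := cu (e / (nrm k + 1)); first by rewrite divr_gt0.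
exists n0 => m n hm hn'; rewrite -scalerBr semiZ.
have := hn m n hm hn'; rewrite ltr_pdivlMr // => h.
by have := semi_ge0 (u m - u n); nra.
Qed.

Lemma cauchy_wrtN u : cauchy_wrt N u -> cauchy_wrt N (fun n => - u n).
Proof.
move=> cu e /cu[n0 hn]; exists n0 => m n hm hn'.
by rewrite -opprD semiN hn.
Qed.

Record cseq := CSeq { cseq_fun : nat -> V ; cseqP : cauchy_wrt N cseq_fun }.

HB.instance Definition _ := gen_eqMixin cseq.
HB.instance Definition _ := gen_choiceMixin cseq.

Definition null_seq (u : nat -> V) := (fun n => N (u n)) @ \oo --> (0 : R).

Definition cseq_eqv (u v : cseq) : bool :=
  `[< null_seq (fun n => cseq_fun u n - cseq_fun v n) >].

Lemma null_seq_le (u v w : nat -> V) : (forall n, N (u n) <= N (v n) + N (w n)) ->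
  null_seq v -> null_seq w -> null_seq u.
Proof.
move=> le hv hw; apply: (@squeeze_cvgr _ _ _ _ (fun=> 0)
    (fun n => N (v n) + N (w n))).
- by near=> n; rewrite semi_ge0 le.
- exact: cvg_cst.
- by rewrite -[0 in X in _ --> X](addr0 0); exact: cvgD.
Unshelve. all: by end_near. Qed.

Lemma null_seq_eq (u v : nat -> V) : (forall n, N (u n) = N (v n)) ->
  null_seq v -> null_seq u.
Proof. by move=> uv; rewrite /null_seq (funext uv). Qed.

Lemma cseq_eqv_refl : reflexive cseq_eqv.
Proof.
move=> u; apply/asboolP; rewrite /null_seq.
rewrite (_ : (fun n => _) = fun=> 0); first exact: cvg_cst.
by apply/funext => n; rewrite subrr semi0.
Qed.

Lemma cseq_eqv_sym : symmetric cseq_eqv.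
Proof.
move=> u v; apply: asbool_equiv_eq.
by split; apply: null_seq_eq => n; rewrite semiBC.
Qed.

Lemma cseq_eqv_trans : transitive cseq_eqv.
Proof.
move=> v u w /asboolP uv /asboolP vw; apply/asboolP.
by apply: null_seq_le uv vw => n; exact: semi_triangle.
Qed.

Canonical cseq_equiv := EquivRel cseq_eqv cseq_eqv_refl cseq_eqv_sym cseq_eqv_trans.

End SeminormTheory.

Definition completion (R : realType) (V : lmodType R[i]) (N : seminorm V) : Type :=
  {eq_quot (cseq_equiv N)}%qT.

Section Completion.
Local Open Scope quotient_scope.
Variables (R : realType) (V : lmodType R[i]) (N : seminorm V).
Local Notation C := (completion N).
Implicit Types (x y z : C) (u v w : nat -> V).

HB.instance Definition _ := Choice.on C.

Definition rep x : nat -> V := cseq_fun (repr (x : {eq_quot (cseq_equiv N)}%qT)).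

Lemma rep_cauchy x : cauchy_wrt N (rep x).
Proof. exact: cseqP. Qed.

(** Sequences that are not Cauchy get a default class, so that classes can be
    formed without carrying proofs. *)
Definition cls u : C := match pselect (cauchy_wrt N u) with
  | left cu => \pi_({eq_quot (cseq_equiv N)}%qT) (CSeq cu)
  | right _ => \pi_({eq_quot (cseq_equiv N)}%qT) (CSeq (cauchy_wrt_cst N 0))
  end.

Lemma clsP u v : cauchy_wrt N u -> cauchy_wrt N v ->
  cls u = cls v <-> null_seq N (fun n => u n - v n).
Proof.
move=> cu cv; rewrite /cls; case: pselect => // pu; case: pselect => // pv.
split=> [/eqmodP /asboolP //|h].
by apply/eqmodP/asboolP.
Qed.

Lemma repK x : cls (rep x) = x.
Proof.
rewrite /cls; case: pselect => [cu|/(_ (rep_cauchy x)) //].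
rewrite -[RHS]reprK /rep /=; congr (\pi_(_) _).
by move: cu; rewrite /rep; case: (repr _) => f cf cu; congr CSeq; exact: Prop_irrelevance.
Qed.

Lemma rep_cls u : cauchy_wrt N u -> null_seq N (fun n => rep (cls u) n - u n).
Proof. by move=> cu; apply/(clsP (rep_cauchy _) cu); rewrite repK. Qed.

Lemma cls_ind (P : C -> Prop) :
  (forall u, cauchy_wrt N u -> P (cls u)) -> forall x, P x.
Proof. by move=> h x; rewrite -(repK x); apply: h; exact: rep_cauchy. Qed.

Definition cadd x y : C := cls (rep x \+ rep y).
Definition copp x : C := cls (fun n => - rep x n).
Definition cscale (k : R[i]) x : C := cls (fun n => k *: rep x n).
Definition czero : C := cls (fun=> 0).

Lemma cadd_cls u v : cauchy_wrt N u -> cauchy_wrt N v ->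
  cadd (cls u) (cls v) = cls (u \+ v).
Proof.
move=> cu cv; apply/clsP; try exact: cauchy_wrtD.
  by apply: cauchy_wrtD; exact: rep_cauchy.
apply: null_seq_le (rep_cls cu) (rep_cls cv) => n /=.
by rewrite opprD addrACA semiD.
Qed.

Lemma copp_cls u : cauchy_wrt N u -> copp (cls u) = cls (fun n => - u n).
Proof.
move=> cu; apply/clsP; try exact: cauchy_wrtN.
  by apply: cauchy_wrtN; exact: rep_cauchy.
by apply: null_seq_eq (rep_cls cu) => n; rewrite -opprD semiN.
Qed.

Lemma cscale_cls k u : cauchy_wrt N u -> cscale k (cls u) = cls (fun n => k *: u n).
Proof.
move=> cu; apply/clsP; try exact: cauchy_wrtZ.
  by apply: cauchy_wrtZ; exact: rep_cauchy.
rewrite /null_seq (_ : (fun n => _) = fun n => nrm k * N (rep (cls u) n - u n)).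
  rewrite -[0 in X in _ --> X](mulr0 (nrm k)).
  by apply: cvgM; [exact: cvg_cst | exact: rep_cls].
by apply/funext => n; rewrite -scalerBr semiZ.
Qed.

Ltac cls_cauchy := by repeat first [ assumption | apply: cauchy_wrt_cst
  | apply: cauchy_wrtD | apply: cauchy_wrtN | apply: cauchy_wrtZ ].

Lemma caddA : associative cadd.
Proof.
elim/cls_ind => u cu; elim/cls_ind => v cv; elim/cls_ind => w cw.
rewrite !cadd_cls; try cls_cauchy.
by congr cls; apply/funext => n /=; rewrite addrA.
Qed.

Lemma caddC : commutative cadd.
Proof.
elim/cls_ind => u cu; elim/cls_ind => v cv.
by rewrite !cadd_cls //; congr cls; apply/funext => n /=; rewrite addrC.
Qed.

Lemma cadd0 : left_id czero cadd.
Proof.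
elim/cls_ind => u cu; rewrite !cadd_cls; try cls_cauchy.
by congr cls; apply/funext => n /=; rewrite add0r.
Qed.

Lemma caddN : left_inverse czero copp cadd.
Proof.
elim/cls_ind => u cu; rewrite copp_cls // cadd_cls; try cls_cauchy.
by congr cls; apply/funext => n /=; rewrite addNr.
Qed.

HB.instance Definition _ := GRing.isZmodule.Build C caddA caddC cadd0 caddN.

Lemma cscaleA a b x : cscale a (cscale b x) = cscale (a * b) x.
Proof.
elim/cls_ind: x => u cu; rewrite !cscale_cls; try cls_cauchy.
by congr cls; apply/funext => n /=; rewrite scalerA.
Qed.

Lemma cscale1 : left_id 1 cscale.
Proof.
elim/cls_ind => u cu; rewrite !cscale_cls; try cls_cauchy.
by congr cls; apply/funext => n /=; rewrite scale1r.
Qed.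

Lemma cscaleDr : right_distributive cscale +%R.
Proof.
move=> k; elim/cls_ind => u cu; elim/cls_ind => v cv; rewrite /GRing.add /=.
rewrite cadd_cls // !cscale_cls; try cls_cauchy.
rewrite cadd_cls; try cls_cauchy.
by congr cls; apply/funext => n /=; rewrite scalerDr.
Qed.

Lemma cscaleDl x : {morph cscale^~ x : a b / a + b}.
Proof.
elim/cls_ind: x => u cu k l; rewrite !cscale_cls // [in RHS]/GRing.add /=.
rewrite cadd_cls; try cls_cauchy.
by congr cls; apply/funext => n /=; rewrite scalerDl.
Qed.

HB.instance Definition _ :=
  GRing.Zmodule_isLmodule.Build R[i] C cscaleA cscale1 cscaleDr cscaleDl.

Lemma clsD u v : cauchy_wrt N u -> cauchy_wrt N v -> cls u + cls v = cls (u \+ v).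
Proof. exact: cadd_cls. Qed.
Lemma clsN u : cauchy_wrt N u -> - cls u = cls (fun n => - u n).
Proof. exact: copp_cls. Qed.
Lemma clsZ k u : cauchy_wrt N u -> k *: cls u = cls (fun n => k *: u n).
Proof. exact: cscale_cls. Qed.

Definition cnorm x : R := lim ((fun n => N (rep x n)) @ \oo).

Lemma cnorm_cls u : cauchy_wrt N u -> (fun n => N (u n)) @ \oo --> cnorm (cls u).
Proof.
move=> cu; have l := cauchy_semi_cvg (rep_cauchy (cls u)).
apply/tends_realP => e e0.
have /tends_realP/(_ (e / 2)) [|n1 h1] := l; first by rewrite divr_gt0.
have /cvgrPdist_lt/(_ (e / 2)) [|n2 _ h2] := rep_cls cu; first by rewrite divr_gt0.
exists (maxn n1 n2) => n; rewrite geq_max => /andP[/h1 {}h1 /h2 /=].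
rewrite sub0r normrN ger0_norm ?semi_ge0 // => {}h2.
rewrite -(subrKA (N (rep (cls u) n))); apply: le_lt_trans (ler_normD _ _) _.
suff : `|N (u n) - N (rep (cls u) n)| <= N (rep (cls u) n - u n).
  by move: h1 h2; rewrite /cnorm; lra.
by rewrite ler_norml semiBC semi_sub_le andbT lerNl opprB semiBC semi_sub_le.
Qed.

Lemma cnorm_uniq u (l : R) : cauchy_wrt N u -> (fun n => N (u n)) @ \oo --> l ->
  cnorm (cls u) = l.
Proof. by move=> /cnorm_cls h; apply: cvg_unique. Qed.

Lemma cnormD x y : cnorm (x + y) <= cnorm x + cnorm y.
Proof.
elim/cls_ind: x => u cu; elim/cls_ind: y => v cv.
rewrite clsD //; apply: (ler_cvg_to (cnorm_cls (cauchy_wrtD cu cv))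
  (cvgD (cnorm_cls cu) (cnorm_cls cv))).
by near=> n; exact: semiD.
Unshelve. all: by end_near. Qed.

Lemma cnormZ k x : cnorm (k *: x) = nrm k * cnorm x.
Proof.
elim/cls_ind: x => u cu; rewrite clsZ //; apply: cnorm_uniq.
  exact: cauchy_wrtZ.
rewrite (_ : (fun n => _) = fun n => nrm k * N (u n)).
  by apply: cvgM; [exact: cvg_cst | exact: cnorm_cls].
by apply/funext => n; rewrite semiZ.
Qed.

Lemma cnorm_eq0 x : cnorm x = 0 -> x = 0.
Proof.
elim/cls_ind: x => u cu h; apply/(clsP cu (cauchy_wrt_cst _ _)).
have := cnorm_cls cu; rewrite h.
by apply: null_seq_eq => n; rewrite subr0.
Qed.

Definition complex_cnorm x : R[i] := (cnorm x)%:C.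

Lemma complex_cnormD x y : complex_cnorm (x + y) <= complex_cnorm x + complex_cnorm y.
Proof. by rewrite -rmorphD lecR cnormD. Qed.

Lemma complex_cnormZ k x : complex_cnorm (k *: x) = `|k| * complex_cnorm x.
Proof. by rewrite /complex_cnorm cnormZ rmorphM /= -normE. Qed.

Lemma complex_cnorm_eq0 x : complex_cnorm x = 0 -> x = 0.
Proof. by move=> /complexI; exact: cnorm_eq0. Qed.

HB.instance Definition _ := Lmodule_isNormed.Build R[i] C
  complex_cnormD complex_cnormZ complex_cnorm_eq0.

Lemma nrm_cnorm x : nrm x = cnorm x. Proof. by []. Qed.

Definition emb (a : V) : C := cls (fun=> a).

Lemma embD a b : emb (a + b) = emb a + emb b.
Proof. by rewrite clsD //; exact: cauchy_wrt_cst. Qed.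

Lemma embN a : emb (- a) = - emb a.
Proof. by rewrite clsN //; exact: cauchy_wrt_cst. Qed.

Lemma embB a b : emb (a - b) = emb a - emb b.
Proof. by rewrite embD embN. Qed.

Lemma embZ k a : emb (k *: a) = k *: emb a.
Proof. by rewrite clsZ //; exact: cauchy_wrt_cst. Qed.

Lemma nrm_emb a : nrm (emb a) = N a.
Proof. by apply: cnorm_uniq (cauchy_wrt_cst _ _) _; exact: cvg_cst. Qed.

Lemma cls_tends u : cauchy_wrt N u -> tends (@nrm R C) (fun n => emb (u n)) (cls u).
Proof.
move=> cu e e0; have [|n0 hn] := cu (e / 2); first by rewrite divr_gt0.
exists n0 => n le_n; apply: (@le_lt_trans _ _ (e / 2)); last by lra.
have cun := cauchy_wrtN cu; rewrite /emb clsN // clsD //; last exact: cauchy_wrt_cst.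
rewrite nrm_cnorm; apply: (cvgr_to_le (cnorm_cls (cauchy_wrtD (cauchy_wrt_cst N (u n)) cun))).
by exists n0 => // m le_m; rewrite /= ltW // hn.
Qed.

Lemma emb_cauchy u : cauchy_wrt (@nrm R C) (fun n => emb (u n)) -> cauchy_wrt N u.
Proof.
move=> cu e /cu[n0 hn]; exists n0 => m n hm hn'.
by have := hn m n hm hn'; rewrite -embB nrm_emb.
Qed.

Lemma emb_dense x : exists2 u, cauchy_wrt N u & tends (@nrm R C) (fun n => emb (u n)) x.
Proof.
exists (rep x); first exact: rep_cauchy.
by rewrite -{2}(repK x); apply: cls_tends; exact: rep_cauchy.
Qed.

(** Choosing original points closer and closer to a Cauchy filter gives a
    Cauchy sequence, whose class is the limit. *)
Lemma completion_complete (F : set_system C) : ProperFilter F -> cauchy F -> cvg F.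
Proof.
move=> FF /cauchyP cF.
have [d [d_gt0 d_le d_small]] : exists d : nat -> R, [/\ forall n, 0 < d n,
    forall m n, (m <= n)%N -> d n <= d m &
    forall e, 0 < e -> exists n0, d n0 < e / 2].
  exists (fun n => n.+1%:R^-1); split=> [n|m n mn|e e0].
  - by rewrite invr_gt0.
  - by rewrite lef_pV2 ?posrE // ler_nat.
  - have e2 : 0 < e / 2 by rewrite divr_gt0.
    have [n0 _ hn0] := near_infty_natSinv_lt (PosNum e2).
    by exists n0; exact: (hn0 n0 (leqnn _)).
have near_emb n : exists a : V, F [set y | nrm (emb a - y) < d n].
  have e2 : 0 < d n / 2 by rewrite divr_gt0.
  have [|x Fx] := cF (d n / 2)%:C; first by rewrite ltcR.
  have [u _ /(_ _ e2)[m /(_ m (leqnn _)) /= um]] := emb_dense x.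
  exists (u m); apply: filterS Fx => y.
  rewrite -ball_normE /ball_ /= normE ltcR => xy.
  by apply: le_lt_trans (nrm_triangle x _ _) _; rewrite [ltRHS]splitr; exact: ltrD.
pose u n := projT1 (cid (near_emb n)).
have Fu n : F [set y | nrm (emb (u n) - y) < d n] := projT2 (cid (near_emb n)).
have cu : cauchy_wrt N u.
  move=> e /d_small[n0 hn0]; exists n0 => m n /d_le hm /d_le hn.
  have [y [/= y1 y2]] := @filter_ex _ _ FF _ (filterI (Fu m) (Fu n)).
  rewrite -nrm_emb embB; apply: le_lt_trans (nrm_triangle y _ _) _.
  by rewrite (nrmBC y); lra.
apply/cvg_ex; exists (cls u); apply/cvgrPdist_lt => e /realC_gt0[e0 ->].
have [n1 hn1] := d_small _ e0.
have [|n2 hn2] := cls_tends cu (e := complex.Re e / 2); first by rewrite divr_gt0.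
pose n := maxn n1 n2; apply: filterS (Fu n) => y /= hy.
rewrite normE ltcR; apply: le_lt_trans (nrm_triangle (emb (u n)) _ _) _.
have /= h2 := hn2 n (leq_maxr _ _); have h1 := d_le n1 n (leq_maxl _ _).
by rewrite (nrmBC (cls u)); lra.
Qed.

HB.instance Definition _ := Uniform_isComplete.Build C completion_complete.

End Completion.

Section CompletionLimits.
Variables (R : realType) (V : lmodType R[i]) (N : seminorm V).
Local Notation C := (completion N).
Implicit Types (u v : nat -> V) (x y : C).

(** Points of the completion are handled through the sequences that represent
    them, so that identities are proved term by term. *)
Definition approx u x := tends (@nrm R C) (fun n => emb N (u n)) x.

Lemma approx_exists x : exists u, approx u x.
Proof. by have [u _ ux] := emb_dense x; exists u. Qed.

Lemma approx_cls u : cauchy_wrt N u -> approx u (cls N u).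
Proof. exact: cls_tends. Qed.

Lemma approx_rep x : approx (rep x) x.
Proof. by rewrite -{2}(repK x); apply: approx_cls; exact: rep_cauchy. Qed.

Lemma approx_cauchy u x : approx u x -> cauchy_wrt N u.
Proof. by move=> ux; apply: emb_cauchy; exact: tends_cauchy ux. Qed.

Lemma approx_emb a : approx (fun=> a) (emb N a).
Proof. exact: tends_cst. Qed.

Lemma approxD u v x y : approx u x -> approx v y -> approx (u \+ v) (x + y).
Proof.
move=> ux vy; rewrite /approx.
rewrite (_ : (fun n => _) = fun n => emb N (u n) + emb N (v n)); first exact: tendsD.
by apply/funext => n; rewrite embD.
Qed.

Lemma approxZ k u x : approx u x -> approx (fun n => k *: u n) (k *: x).
Proof.
move=> ux; rewrite /approx.
rewrite (_ : (fun n => _) = fun n => k *: emb N (u n)); first exact: tendsZ.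
by apply/funext => n; rewrite embZ.
Qed.

Lemma approx_null u v x : approx u x -> null_seq N (fun n => u n - v n) -> approx v x.
Proof.
move=> /tends_cvg ux uv.
apply: (@tends_squeeze _ _ _ _ (fun n => nrm (emb N (u n) - x) + N (u n - v n))).
  move=> n; rewrite [leRHS]addrC -(nrm_emb N (u n - v n)) embB.
  rewrite (nrmBC (emb N (u n)) (emb N (v n))); exact: nrm_triangle.
by rewrite -[0 in X in _ --> X](addr0 0); exact: cvgD.
Qed.

Lemma approx_diff u v x : approx u x -> approx v x -> null_seq N (fun n => u n - v n).
Proof.
move=> ux vx; have /tends_cvg := tendsB ux vx; rewrite subrr.
rewrite (_ : (fun n => _) = (fun n => N (u n - v n))) //.
by apply/funext => n; rewrite subr0 -embB nrm_emb.
Qed.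

Lemma approx_unique u x y : approx u x -> approx u y -> x = y.
Proof. exact: tends_unique. Qed.

Lemma approx_eq u v x y : approx u x -> approx v y -> (forall n, u n = v n) -> x = y.
Proof. by move=> ux vy /funext uv; apply: (approx_unique ux); rewrite uv. Qed.

Lemma approx_nrm u x : approx u x -> (fun n => N (u n)) @ \oo --> nrm x.
Proof.
move=> /tends_nrm; rewrite (_ : (fun n => _) = fun n => N (u n)) //.
by apply/funext => n; rewrite nrm_emb.
Qed.

Lemma cauchy_bounded u : cauchy_wrt N u -> exists2 M, 0 <= M & forall n, N (u n) <= M.
Proof.
move=> /cauchy_semi_cvg /cvg_seq_bounded [M [_ hM]].
exists (`|M| + 1); first by rewrite addr_ge0.
move=> n; have := hM (`|M| + 1); rewrite (le_lt_trans (ler_norm M)) ?ltrDl //.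
by move=> /(_ isT n I) /=; apply: le_trans; exact: ler_norm.
Qed.

Variables (E : completeNormedModType R[i]) (f : V -> E) (M : R).
Hypotheses (f_lin : linear f) (f_bound : forall a, nrm (f a) <= M * N a).

(** The limit exists by completeness of [E]; this is a total function so that
    it can be named before that is known. *)
Definition extend (x : C) : E := xget 0 [set l | tends (@nrm R E) (fun n => f (rep x n)) l].

Let fL : {linear V -> E} := HB.pack f (GRing.isLinear.Build R[i] V E *:%R f f_lin).

Lemma extend_approx u x : approx u x -> tends (@nrm R E) (fun n => f (u n)) (extend x).
Proof.
have fB a b : f (a - b) = f a - f b := linearB fL a b.
move=> ux; have rx := approx_rep x.
have [l hl] : exists l, tends (@nrm R E) (fun n => f (rep x n)) l.
  apply: nrm_complete => e e0.
  have M1 : 0 < `|M| + 1 by rewrite ltr_wpDl.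
  have [|n0 hn] := approx_cauchy rx (e := e / (`|M| + 1)); first by rewrite divr_gt0.
  exists n0 => m n hm hn'; have := hn m n hm hn'; rewrite ltr_pdivlMr // -fB.
  apply: le_lt_trans; apply: le_trans (f_bound _) _; rewrite mulrC.
  apply: ler_wpM2l; first exact: semi_ge0.
  by apply: le_trans (ler_norm M) _; rewrite lerDl.
have /tends_cvg hx := xgetI 0 hl; rewrite -/(extend x) in hx.
apply: (@tends_squeeze _ _ _ _
    (fun n => nrm (f (rep x n) - extend x) + M * N (u n - rep x n))).
  move=> n; rewrite [leRHS]addrC; apply: le_trans (nrm_triangle (f (rep x n)) _ _) _.
  by rewrite lerD2r -fB f_bound.
rewrite -[0 in X in _ --> X](addr0 0); apply: cvgD => //.
rewrite -[0 in X in _ --> X](mulr0 M); apply: cvgM; first exact: cvg_cst.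
exact: (approx_diff ux rx).
Qed.

Lemma extend_emb a : extend (emb N a) = f a.
Proof.
by apply: (tends_unique (extend_approx (approx_emb a))); exact: tends_cst.
Qed.

Lemma extend_linear : linear extend.
Proof.
move=> k x y; have [u ux] := approx_exists x; have [v vy] := approx_exists y.
apply: (tends_unique (extend_approx (approxD (approxZ k ux) vy))).
rewrite (_ : (fun n => _) = fun n => k *: f (u n) + f (v n)).
  by apply: tendsD; [apply: tendsZ|]; exact: extend_approx.
by apply/funext => n; rewrite -f_lin.
Qed.

Lemma extend_bound x : nrm (extend x) <= M * nrm x.
Proof.
have [u ux] := approx_exists x.
apply: (ler_cvg_to (tends_nrm (extend_approx ux)) (cvgM (cvg_cst M) (approx_nrm ux))).
by near=> n; exact: f_bound.
Unshelve. all: by end_near. Qed.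

End CompletionLimits.

(** * The enveloping C*-algebra *)

Section Envelope.
Variables (R : realType) (A : unitalStarAlgType R) (hA : bounded_algebra A).

Definition anorm_seminorm : seminorm A := Seminorm (anormD hA) (anormZ hA).
End Envelope.

Definition envelope (R : realType) (A : unitalStarAlgType R) (hA : bounded_algebra A) :
  Type := completion (anorm_seminorm hA).

Section EnvelopeAlgebra.
Variables (R : realType) (A : unitalStarAlgType R) (hA : bounded_algebra A).
Local Notation B := (envelope hA).
Local Notation N := (anorm_seminorm hA).
Implicit Types (x y z : B) (u v : nat -> A).

HB.instance Definition _ := CompleteNormedModule.copy B (completion N).

Definition env_mul x y : B := cls N (fun n => rep x n ** rep y n).
Definition env_star x : B := cls N (fun n => star (rep x n)).

Lemma mul_diff_le (a b c d : A) :
  anorm (a ** b - c ** d) <= anorm (a - c) * anorm b + anorm c * anorm (b - d).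
Proof.
have -> : a ** b - c ** d = (a - c) ** b + c ** (b - d).
  by star_identity R; ring.
by apply: le_trans (anormD hA _ _) _; rewrite lerD // anormM.
Qed.

Lemma cauchy_mul u v : cauchy_wrt N u -> cauchy_wrt N v ->
  cauchy_wrt N (fun n => u n ** v n).
Proof.
move=> cu cv e e0.
have [M M0 hM] := cauchy_bounded cu; have [L L0 hL] := cauchy_bounded cv.
have K0 : 0 < M + L + 1 by lra.
have d0 : 0 < e / (M + L + 1) by rewrite divr_gt0.
have [n1 h1] := cu _ d0; have [n2 h2] := cv _ d0.
exists (maxn n1 n2) => m n; rewrite !geq_max => /andP[m1 m2] /andP[k1 k2].
apply: le_lt_trans (mul_diff_le _ _ _ _) _.
have {h1} := h1 m n m1 k1; have {h2} := h2 m n m2 k2; rewrite /= !ltr_pdivlMr //.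
move: (hM n) (hL m) (anorm_ge0 (u m - u n)) (anorm_ge0 (v m - v n)) => /=.
move: (anorm_ge0 (u n)) (anorm_ge0 (v m)).
set a := anorm (u m - u n); set b := anorm (v m - v n) => *.
have : a * anorm (v m) <= a * L by rewrite ler_wpM2l.
have : anorm (u n) * b <= M * b by rewrite ler_wpM2r.
have [|] := leP a b; nra.
Qed.

Lemma cauchy_star u : cauchy_wrt N u -> cauchy_wrt N (fun n => star (u n)).
Proof.
move=> cu e /cu[n0 hn]; exists n0 => m n hm hn'.
by rewrite -starB /= anorm_star //; exact: hn.
Qed.

Lemma approx_mul u v x y : approx u x -> approx v y ->
  approx (N := N) (fun n => u n ** v n) (env_mul x y).
Proof.
move=> ux vy; have rx := approx_rep x; have ry := approx_rep y.
have [L L0 hL] := cauchy_bounded (approx_cauchy ry).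
have [M M0 hM] := cauchy_bounded (approx_cauchy ux).
apply: (@approx_null _ _ N (fun n => rep x n ** rep y n)).
  exact: (approx_cls (cauchy_mul (approx_cauchy rx) (approx_cauchy ry))).
apply: (@squeeze_cvgr _ _ _ _ (fun=> 0)
  (fun n => anorm (rep x n - u n) * L + M * anorm (rep y n - v n))).
- near=> n; rewrite semi_ge0 /=; apply: le_trans (mul_diff_le _ _ _ _) _.
  by apply: lerD; rewrite ?ler_wpM2l ?ler_wpM2r ?anorm_ge0 //; [exact: hL|exact: hM].
- exact: cvg_cst.
rewrite -[0 in X in _ --> X](addr0 0); apply: cvgD.
  rewrite -[0 in X in _ --> X](mul0r L); apply: cvgM; last exact: cvg_cst.
  exact: (approx_diff rx ux).
rewrite -[0 in X in _ --> X](mulr0 M); apply: cvgM; first exact: cvg_cst.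
exact: (approx_diff ry vy).
Unshelve. all: by end_near. Qed.

Lemma approx_star u x : approx u x -> approx (N := N) (fun n => star (u n)) (env_star x).
Proof.
move=> ux; have rx := approx_rep x.
apply: (@approx_null _ _ N (fun n => star (rep x n))).
  exact: (approx_cls (cauchy_star (approx_cauchy rx))).
apply: null_seq_eq (approx_diff rx ux) => n.
by rewrite -starB /= anorm_star.
Qed.

(** Each identity holds along representing sequences, hence in the limit. *)
Lemma env_mulA x y z : env_mul x (env_mul y z) = env_mul (env_mul x y) z.
Proof.
have [u ux] := approx_exists x; have [v vy] := approx_exists y.
have [w wz] := approx_exists z.
by apply: (approx_eq (approx_mul ux (approx_mul vy wz))
  (approx_mul (approx_mul ux vy) wz)) => n; rewrite amulA.
Qed.

Lemma env_mulDl x y z : env_mul (x + y) z = env_mul x z + env_mul y z.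
Proof.
have [u ux] := approx_exists x; have [v vy] := approx_exists y.
have [w wz] := approx_exists z.
by apply: (approx_eq (approx_mul (approxD ux vy) wz)
  (approxD (approx_mul ux wz) (approx_mul vy wz))) => n; rewrite /= amulDl.
Qed.

Lemma env_mulDr x y z : env_mul x (y + z) = env_mul x y + env_mul x z.
Proof.
have [u ux] := approx_exists x; have [v vy] := approx_exists y.
have [w wz] := approx_exists z.
by apply: (approx_eq (approx_mul ux (approxD vy wz))
  (approxD (approx_mul ux vy) (approx_mul ux wz))) => n; rewrite /= amulDr.
Qed.

Lemma env_mulZl k x y : env_mul (k *: x) y = k *: env_mul x y.
Proof.
have [u ux] := approx_exists x; have [v vy] := approx_exists y.
by apply: (approx_eq (approx_mul (approxZ k ux) vy)
  (approxZ k (approx_mul ux vy))) => n; rewrite /= amulZl.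
Qed.

Lemma env_mulZr k x y : env_mul x (k *: y) = k *: env_mul x y.
Proof.
have [u ux] := approx_exists x; have [v vy] := approx_exists y.
by apply: (approx_eq (approx_mul ux (approxZ k vy))
  (approxZ k (approx_mul ux vy))) => n; rewrite /= amulZr.
Qed.

Lemma env_starD x y : env_star (x + y) = env_star x + env_star y.
Proof.
have [u ux] := approx_exists x; have [v vy] := approx_exists y.
by apply: (approx_eq (approx_star (approxD ux vy))
  (approxD (approx_star ux) (approx_star vy))) => n; rewrite /= starD.
Qed.

Lemma env_starZ k x : env_star (k *: x) = Num.conj k *: env_star x.
Proof.
have [u ux] := approx_exists x.
by apply: (approx_eq (approx_star (approxZ k ux))
  (approxZ _ (approx_star ux))) => n; rewrite /= starZ.
Qed.

Lemma env_starM x y : env_star (env_mul x y) = env_mul (env_star y) (env_star x).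
Proof.
have [u ux] := approx_exists x; have [v vy] := approx_exists y.
by apply: (approx_eq (approx_star (approx_mul ux vy))
  (approx_mul (approx_star vy) (approx_star ux))) => n; rewrite /= starM.
Qed.

Lemma env_starK x : env_star (env_star x) = x.
Proof.
have [u ux] := approx_exists x.
by apply: (approx_eq (approx_star (approx_star ux)) ux) => n; rewrite starK.
Qed.

HB.instance Definition _ := isStarAlgebra.Build R B env_mulA env_mulDl env_mulDr
  env_mulZl env_mulZr env_starD env_starZ env_starM env_starK.

Lemma env_norm_mul x y : `|x ** y| <= `|x| * `|y|.
Proof.
rewrite !normE -rmorphM lecR.
have [u ux] := approx_exists x; have [v vy] := approx_exists y.
apply: (ler_cvg_to (approx_nrm (approx_mul ux vy))
  (cvgM (approx_nrm ux) (approx_nrm vy))).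
by near=> n; exact: anormM.
Unshelve. all: by end_near. Qed.

Lemma env_norm_star_mul x : `|star x ** x| = `|x| ^+ 2.
Proof.
rewrite !normE -rmorphXn; congr (_%:C).
have [u ux] := approx_exists x.
apply: (cvg_unique _ (approx_nrm (approx_mul (approx_star ux) ux))) => //.
rewrite (_ : (fun n => _) = fun n => anorm (u n) * anorm (u n)).
  by rewrite expr2; apply: cvgM; exact: approx_nrm ux.
by apply/funext => n; rewrite -expr2 -(anorm_star_mul hA).
Qed.

HB.instance Definition _ := isCStarAlgebra.Build R B env_norm_mul env_norm_star_mul.

Definition env_emb (a : A) : B := emb N a.

Lemma env_emb_morphism : star_morphism env_emb.
Proof.
split=> [k a b|a b|a].
- by rewrite /env_emb embD embZ.
- exact: (approx_unique (approx_emb _ _) (approx_mul (approx_emb _ _) (approx_emb _ _))).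
- exact: (approx_unique (approx_emb _ _) (approx_star (approx_emb _ _))).
Qed.

Lemma nrm_env_emb a : nrm (env_emb a) = anorm a.
Proof. exact: (nrm_emb N). Qed.

(** [|phi(x)|^2 <= r] as soon as [r - x^* x] is in the cone, hence for every
    [r] above [|x|^2]. *)
Lemma star_morphism_anorm (D : cstarAlgType R) (phi : A -> D) :
  star_morphism phi -> forall a, nrm (phi a) <= anorm a.
Proof.
move=> hphi a; apply: le_of_all_gt => r ar.
have r0 : 0 <= r := le_trans (anorm_ge0 _) (ltW ar).
rewrite -(@ler_pXn2r _ 2) ?nnegrE ?nrm_ge0 //.
by apply: (star_morphism_sqr_bound hphi); [exact: sqr_ge0 | exact: anorm_lt].
Qed.

(** Morphisms out of [A] are bounded by the algebraic seminorm, so they extend;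
    morphisms out of the envelope are contractive, so the extension is unique. *)
Theorem envelope_universal : universal_enveloping env_emb.
Proof.
split; first exact: env_emb_morphism.
move=> D phi hphi; have [phi_lin phiM phi_star] := hphi.
have bound a : nrm (phi a) <= 1 * N a by rewrite mul1r; exact: star_morphism_anorm.
pose psi (x : B) : D := extend (N := N) phi x.
have psi_approx u x : approx u x -> tends (@nrm R D) (fun n => phi (u n)) (psi x).
  exact: (extend_approx phi_lin bound).
exists psi; split.
  split; last by move=> a; exact: (extend_emb phi_lin bound).
  split=> [|x y|x].
  - exact: (extend_linear phi_lin bound).
  - have [u ux] := approx_exists x; have [v vy] := approx_exists y.
    apply: (tends_unique (psi_approx _ _ (approx_mul ux vy))).
    have ru := psi_approx _ _ ux; have rv := psi_approx _ _ vy.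
    have [L L0 hL] : exists2 L, 0 <= L & forall n, nrm (phi (v n)) <= L.
      have [L L0 hL] := cauchy_bounded (approx_cauchy vy).
      by exists L => // n; apply: le_trans (hL n); rewrite -[leRHS]mul1r.
    move/tends_cvg in ru; move/tends_cvg in rv.
    apply: (@tends_squeeze _ _ _ _ (fun n => nrm (phi (u n) - psi x) * L +
       nrm (psi x) * nrm (phi (v n) - psi y))).
      move=> n; rewrite phiM.
      have -> : phi (u n) ** phi (v n) - psi x ** psi y =
          (phi (u n) - psi x) ** phi (v n) + psi x ** (phi (v n) - psi y).
        by move: (phi _) (phi _) (psi _) (psi _) => a b c d; star_identity R; ring.
      apply: le_trans (nrmD _ _) (lerD _ (nrm_amul _ _)).
      by apply: le_trans (nrm_amul _ _) _; rewrite ler_wpM2l ?nrm_ge0.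
    rewrite -[0 in X in _ --> X](addr0 0); apply: cvgD.
      by rewrite -[0 in X in _ --> X](mul0r L); apply: cvgM => //; exact: cvg_cst.
    by rewrite -[0 in X in _ --> X](mulr0 (nrm (psi x))); apply: cvgM => //; exact: cvg_cst.
  - have [u ux] := approx_exists x.
    apply: (tends_unique (psi_approx _ _ (approx_star ux))).
    rewrite (_ : (fun n => _) = fun n => star (phi (u n))).
      by apply: tends_star; exact: psi_approx.
    by apply/funext => n.
move=> psi' [hpsi' psi'E]; apply/funext => x.
have [psi'_lin _ _] := hpsi'.
have [u ux] := approx_exists x.
apply: (tends_unique (psi_approx _ _ ux)).
have psi'B a b : psi' (a - b) = psi' a - psi' b.
  pose psiL : {linear B -> D} := HB.pack psi'
    (GRing.isLinear.Build R[i] B D *:%R psi' psi'_lin).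
  exact: (linearB psiL).
move=> e /ux[n0 hn]; exists n0 => n /hn; apply: le_lt_trans.
by rewrite -psi'E -psi'B; exact: (star_morphism_contractive hpsi').
Qed.

End EnvelopeAlgebra.

(** * Hilbert space of a semi-inner product *)

Section ComplexParts.
Variable R : realType.
Implicit Types (k w : R[i]).

Lemma Re_add k w : complex.Re (k + w) = complex.Re k + complex.Re w.
Proof. by case: k w => [a b] [c d]. Qed.
Lemma Im_add k w : complex.Im (k + w) = complex.Im k + complex.Im w.
Proof. by case: k w => [a b] [c d]. Qed.
Lemma Re_opp k : complex.Re (- k) = - complex.Re k.
Proof. by case: k. Qed.
Lemma Re_mul k w : complex.Re (k * w) =
  complex.Re k * complex.Re w - complex.Im k * complex.Im w.
Proof. by case: k w => [a b] [c d]. Qed.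
Lemma Im_mul k w : complex.Im (k * w) =
  complex.Re k * complex.Im w + complex.Im k * complex.Re w.
Proof. by case: k w => [a b] [c d]. Qed.
Lemma Re_conjE k : complex.Re (Num.conj k) = complex.Re k.
Proof. by case: k. Qed.
Lemma Im_conjE k : complex.Im (Num.conj k) = - complex.Im k.
Proof. by case: k. Qed.
Lemma Re_realM (r : R) k : complex.Re (r%:C * k) = r * complex.Re k.
Proof. by rewrite Re_mul /= mul0r subr0. Qed.

Lemma Re_conji k : complex.Re (Num.conj 'i * k) = complex.Im k.
Proof. by rewrite -complexiE Re_mul Re_conjE Im_conjE /= mul0r sub0r mulN1r opprK. Qed.

Lemma complex_ext k w : complex.Re k = complex.Re w -> complex.Im k = complex.Im w ->
  k = w.
Proof. by case: k w => [a b] [c d] /= -> ->. Qed.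

Lemma complex_ge0 w : 0 <= w -> w = (complex.Re w)%:C /\ 0 <= complex.Re w.
Proof. by case: w => a b /andP[/eqP /= -> h]. Qed.

(** Convergence of complex sequences, by parts. *)
Definition ctends (u : nat -> R[i]) (l : R[i]) :=
  (fun n => complex.Re (u n)) @ \oo --> complex.Re l /\
  (fun n => complex.Im (u n)) @ \oo --> complex.Im l.

Lemma ctends_eq u v k w : ctends u k -> ctends v w -> (forall n, u n = v n) -> k = w.
Proof.
move=> [ur ui] [vr vi] /funext uv; subst v.
by apply: complex_ext; [move: ur vr | move: ui vi]; exact: cvg_unique.
Qed.

Lemma ctendsD u v k w : ctends u k -> ctends v w -> ctends (fun n => u n + v n) (k + w).
Proof.
move=> [ur ui] [vr vi]; split.
  rewrite Re_add (_ : (fun n => _) = fun n => complex.Re (u n) + complex.Re (v n)).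
    exact: cvgD.
  by apply/funext => n; rewrite Re_add.
rewrite Im_add (_ : (fun n => _) = fun n => complex.Im (u n) + complex.Im (v n)).
  exact: cvgD.
by apply/funext => n; rewrite Im_add.
Qed.

Lemma ctendsM u c k : ctends u k -> ctends (fun n => c * u n) (c * k).
Proof.
move=> [ur ui]; split.
  rewrite Re_mul (_ : (fun n => _) = fun n =>
      complex.Re c * complex.Re (u n) - complex.Im c * complex.Im (u n)).
    by apply: cvgB; apply: cvgM => //; exact: cvg_cst.
  by apply/funext => n; rewrite Re_mul.
rewrite Im_mul (_ : (fun n => _) = fun n =>
    complex.Re c * complex.Im (u n) + complex.Im c * complex.Re (u n)).
  by apply: cvgD; apply: cvgM => //; exact: cvg_cst.
by apply/funext => n; rewrite Im_mul.
Qed.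

Lemma ctends_conj u k : ctends u k -> ctends (fun n => Num.conj (u n)) (Num.conj k).
Proof.
move=> [ur ui]; split.
  rewrite Re_conjE (_ : (fun n => _) = fun n => complex.Re (u n)) //.
  by apply/funext => n; rewrite Re_conjE.
rewrite Im_conjE (_ : (fun n => _) = fun n => - complex.Im (u n)).
  exact: cvgN.
by apply/funext => n; rewrite Im_conjE.
Qed.

End ComplexParts.

Record preinner (R : realType) (V : lmodType R[i]) := PreInner {
  pin :> V -> V -> R[i] ;
  pin_linear : forall k a b c, pin (k *: a + b) c = k * pin a c + pin b c ;
  pin_conj : forall a b, pin b a = Num.conj (pin a b) ;
  pin_ge0 : forall a, 0 <= pin a a
}.

Section PreInnerTheory.
Variables (R : realType) (V : lmodType R[i]) (g : preinner V).
Implicit Types (a b c : V).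

Lemma pin0l c : g 0 c = 0.
Proof.
have := pin_linear g 1 0 0 c; rewrite scale1r addr0 mul1r => /eqP.
by rewrite -[X in X == _]addr0 (inj_eq (addrI _)) eq_sym => /eqP.
Qed.

Lemma pinD a b c : g (a + b) c = g a c + g b c.
Proof. by rewrite -[a]scale1r pin_linear mul1r scale1r. Qed.
Lemma pinZ k a c : g (k *: a) c = k * g a c.
Proof. by rewrite -[k *: a]addr0 pin_linear pin0l addr0. Qed.
Lemma pinDr a b c : g c (a + b) = g c a + g c b.
Proof. by rewrite pin_conj pinD rmorphD /= -!pin_conj. Qed.
Lemma pinZr k a c : g c (k *: a) = Num.conj k * g c a.
Proof. by rewrite pin_conj pinZ rmorphM /= -pin_conj. Qed.

Definition re_pin a b := complex.Re (g a b).

Lemma pin_sqr a : g a a = (re_pin a a)%:C.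
Proof. by have [] := complex_ge0 (pin_ge0 g a). Qed.

Lemma re_pin_ge0 a : 0 <= re_pin a a.
Proof. by have [] := complex_ge0 (pin_ge0 g a). Qed.

Lemma re_pinC a b : re_pin b a = re_pin a b.
Proof. by rewrite /re_pin pin_conj Re_conjE. Qed.

Lemma re_pin_comb (s t : R) a b : re_pin (s%:C *: a + t%:C *: b) (s%:C *: a + t%:C *: b)
  = s ^+ 2 * re_pin a a + t ^+ 2 * re_pin b b + 2 * s * t * re_pin a b.
Proof.
have E := re_pinC a b; rewrite /re_pin in E *.
by rewrite pinD !pinDr !pinZ !pinZr !conjCr !Re_add !Re_realM E; ring.
Qed.

Definition pnorm a : R := Num.sqrt (re_pin a a).

Lemma pnorm_sqr a : pnorm a ^+ 2 = re_pin a a.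
Proof. by rewrite sqr_sqrtr // re_pin_ge0. Qed.

Lemma pnorm_ge0 a : 0 <= pnorm a. Proof. exact: sqrtr_ge0. Qed.

(** Cauchy-Schwarz from the positivity of the form at [s a - r b], for [r] and
    [s] above the two norms; strict bounds avoid dividing by a null norm. *)
Lemma re_pin_le a b : re_pin a b <= pnorm a * pnorm b.
Proof.
apply: le_mul_of_all_gt; rewrite ?pnorm_ge0 // => r s ar bs.
have r0 : 0 < r := le_lt_trans (pnorm_ge0 _) ar.
have s0 : 0 < s := le_lt_trans (pnorm_ge0 _) bs.
have := re_pin_ge0 (s%:C *: a + (- r)%:C *: b).
rewrite re_pin_comb -!pnorm_sqr.
have ha : pnorm a ^+ 2 <= r ^+ 2 by rewrite ler_sqr ?nnegrE ?pnorm_ge0 ?ltW.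
have hb : pnorm b ^+ 2 <= s ^+ 2 by rewrite ler_sqr ?nnegrE ?pnorm_ge0 ?ltW.
have {}ha : s ^+ 2 * pnorm a ^+ 2 <= s ^+ 2 * r ^+ 2 by rewrite ler_wpM2l ?sqr_ge0.
have {}hb : r ^+ 2 * pnorm b ^+ 2 <= r ^+ 2 * s ^+ 2 by rewrite ler_wpM2l ?sqr_ge0.
have rs : 0 < r * s by rewrite mulr_gt0.
rewrite sqrrN => h; rewrite -(ler_pM2l rs); lra.
Qed.

Lemma pnormD a b : pnorm (a + b) <= pnorm a + pnorm b.
Proof.
rewrite -(@ler_pXn2r _ 2) ?nnegrE ?addr_ge0 ?pnorm_ge0 // pnorm_sqr.
have := re_pin_comb 1 1 a b; rewrite scale1r !scale1r => ->.
by have := re_pin_le a b; rewrite -!pnorm_sqr; lra.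
Qed.

Lemma pnormZ k a : pnorm (k *: a) = nrm k * pnorm a.
Proof.
apply/eqP; rewrite -(@eqrXn2 _ 2) ?mulr_ge0 ?pnorm_ge0 //; last first.
  by rewrite -lecR -normE normr_ge0.
rewrite exprMn !pnorm_sqr /re_pin pinZ pinZr mulrA -normCK normE -rmorphXn.
by rewrite Re_realM.
Qed.

Definition pin_seminorm : seminorm V := Seminorm pnormD pnormZ.

End PreInnerTheory.

Definition hspace (R : realType) (V : lmodType R[i]) (g : preinner V) : Type :=
  completion (pin_seminorm g).

Section HilbertCompletion.
Variables (R : realType) (V : lmodType R[i]) (g : preinner V).
Local Notation N := (pin_seminorm g).
Local Notation H := (hspace g).
Implicit Types (x y z : H) (u v w : nat -> V).

HB.instance Definition _ := CompleteNormedModule.copy H (completion N).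

Definition hre x y : R := (nrm (x + y) ^+ 2 - nrm (x - y) ^+ 2) / 4.

(** The inner product is recovered from the norm by polarization. *)
Definition hip x y : R[i] := Complex (hre x y) (hre x ('i *: y)).

Lemma approx_hre u v x y : approx (N := N) u x -> approx (N := N) v y ->
  (fun n => complex.Re (g (u n) (v n))) @ \oo --> hre x y.
Proof.
move=> ux vy.
have cD := approx_nrm (approxD ux vy).
have cB := approx_nrm (approxD ux (approxZ (-1) vy)).
rewrite scaleN1r in cB.
rewrite /hre !expr2 (_ : (fun n => _) = fun n =>
    (N (u n + v n) * N (u n + v n) - N (u n + -1 *: v n) * N (u n + -1 *: v n)) / 4).
  apply: cvgM; last exact: cvg_cst.
  by apply: cvgB; [exact: (cvgM cD cD) | exact: (cvgM cB cB)].
apply/funext => n; rewrite -!expr2 !pnorm_sqr.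
have := re_pin_comb g 1 1 (u n) (v n); have := re_pin_comb g 1 (-1) (u n) (v n).
by rewrite rmorphN1 !scale1r => -> ->; rewrite /re_pin; field.
Qed.

Lemma approx_hip u v x y : approx (N := N) u x -> approx (N := N) v y ->
  ctends (fun n => g (u n) (v n)) (hip x y).
Proof.
move=> ux vy; split; first exact: approx_hre.
have := approx_hre ux (approxZ 'i vy).
rewrite (_ : (fun n => _) = fun n => complex.Im (g (u n) (v n))) //.
by apply/funext => n; rewrite pinZr Re_conji.
Qed.

Lemma hip_linearl z : linear_for *%R (hip ^~ z).
Proof.
move=> k x y; have [u ux] := approx_exists x; have [v vy] := approx_exists y.
have [w wz] := approx_exists z.
by apply: (ctends_eq (approx_hip (approxD (approxZ k ux) vy) wz)
  (ctendsD (ctendsM k (approx_hip ux wz)) (approx_hip vy wz))) => n; rewrite pin_linear.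
Qed.

Lemma hip_conj x y : hip y x = Num.conj (hip x y).
Proof.
have [u ux] := approx_exists x; have [v vy] := approx_exists y.
by apply: (ctends_eq (approx_hip vy ux) (ctends_conj (approx_hip ux vy))) => n;
  rewrite pin_conj.
Qed.

Lemma hip_linearr z : linear_for (Num.conj \; *%R) (hip z).
Proof.
move=> k x y; rewrite hip_conj [hip z x]hip_conj [hip z y]hip_conj hip_linearl.
by rewrite rmorphD rmorphM.
Qed.

Lemma hip_sqr x : hip x x = `|x| ^+ 2.
Proof.
have [u ux] := approx_exists x; rewrite normE -rmorphXn.
apply: (ctends_eq (approx_hip ux ux) (v := fun n => (pnorm g (u n) ^+ 2)%:C)).
  split=> /=; last exact: cvg_cst.
  by rewrite expr2; apply: cvgM; exact: approx_nrm ux.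
by move=> n; rewrite pnorm_sqr pin_sqr.
Qed.

HB.instance Definition _ := bilinear_isBilinear.Build R[i] H H R[i] *%R
  (Num.conj \; *%R) hip (hip_linearl, hip_linearr).

Lemma hip_hermitian x y : hip x y = (-1) ^+ false * Num.conj (hip y x).
Proof. by rewrite mul1r hip_conj. Qed.

HB.instance Definition _ := isHermitianSesquilinear.Build R[i] H false (@Num.conj R[i])
  hip hip_hermitian.

Lemma hip_gt0 x : x != 0 -> 0 < hip x x.
Proof. by move=> x0; rewrite hip_sqr exprn_gt0 // normr_gt0. Qed.

HB.instance Definition _ := isDotProduct.Build R[i] H hip hip_gt0.

HB.instance Definition _ := isHilbert.Build R H (hdot := hip : {dot H for (@Num.conj R[i])}) hip_sqr.

End HilbertCompletion.

(** * Extreme functionals below a sublinear one *)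

Section Extreme.
Variables (R : realType) (V : lmodType R[i]).
Implicit Types (x y a b : V) (t s : R) (p q : V -> R) (F G : V -> R).

Definition sublinear q := (forall x y, q (x + y) <= q x + q y) /\
  (forall t x, 0 <= t -> q (t%:C *: x) <= t * q x).

Definition real_linear F := (forall x y, F (x + y) = F x + F y) /\
  (forall t x, F (t%:C *: x) = t * F x).

Definition le_fun F G := forall x, F x <= G x.

Lemma sublinear0 q : sublinear q -> q 0 = 0.
Proof.
move=> [qD qZ]; have := qD 0 0; have := qZ 0 0 (lexx _).
by rewrite scale0r mul0r addr0; lra.
Qed.

Lemma sublinear_opp q x : sublinear q -> - q (- x) <= q x.
Proof.
move=> q_sub; have := q_sub.1 x (- x).
by rewrite subrr sublinear0 //; lra.
Qed.

Lemma sublinearZ q t x : sublinear q -> 0 <= t -> q (t%:C *: x) = t * q x.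
Proof.
move=> q_sub; rewrite le_eqVlt => /predU1P[<-|t0].
  by rewrite scale0r mul0r sublinear0.
apply/le_anti; rewrite q_sub.2 ?(ltW t0) //=.
have := q_sub.2 t^-1 (t%:C *: x); rewrite invr_ge0 (ltW t0) => /(_ isT).
rewrite scalerA -rmorphM mulVf ?gt_eqF // scale1r => h.
by rewrite -(ler_pM2l (_ : 0 < t^-1)) ?invr_gt0 // mulrA mulVf ?mul1r ?gt_eqF.
Qed.

Lemma real_linear0 F : real_linear F -> F 0 = 0.
Proof. by move=> [_ FZ]; have := FZ 0 0; rewrite scale0r mul0r. Qed.

Lemma real_linearN F x : real_linear F -> F (- x) = - F x.
Proof.
move=> F_lin; apply/eqP; rewrite -addr_eq0 -F_lin.1 addNr.
by rewrite real_linear0.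
Qed.

Lemma real_linearB F x y : real_linear F -> F (x - y) = F x - F y.
Proof. by move=> F_lin; rewrite F_lin.1 real_linearN. Qed.

Lemma inf_le_elt (E : set R) (l x : R) : lbound E l -> E x -> inf E <= x.
Proof. by move=> El Ex; apply: ge_inf => //; exists l. Qed.

(** [exposed q a] is the support function of the face of
    [{F linear, F <= q}] on which [F a] is maximal. *)
Definition exposed q a x : R :=
  inf [set q (x + t%:C *: a) - t * q a | t in [set t | 0 <= t]].

Section Exposed.
Variables (q : V -> R) (a : V).
Hypothesis q_sub : sublinear q.

Lemma exposed_lb x :
  lbound [set q (x + t%:C *: a) - t * q a | t in [set t | 0 <= t]] (- q (- x)).
Proof.
move=> _ [t t0 <-]; have := q_sub.1 (x + t%:C *: a) (- x).
by rewrite addrAC subrr add0r sublinearZ //; lra.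
Qed.

Lemma exposed_le x t : 0 <= t -> exposed q a x <= q (x + t%:C *: a) - t * q a.
Proof. by move=> t0; apply: inf_le_elt (@exposed_lb x) _; exists t. Qed.

Lemma exposed_ge x l : (forall t, 0 <= t -> l <= q (x + t%:C *: a) - t * q a) ->
  l <= exposed q a x.
Proof.
move=> h; apply: lb_le_inf; first by exists (q (x + 0%:C *: a) - 0 * q a), 0; rewrite /=.
by move=> _ [t t0 <-]; exact: h.
Qed.

Lemma exposed_approx x r : exposed q a x < r ->
  exists2 t, 0 <= t & q (x + t%:C *: a) - t * q a < r.
Proof.
move=> xr; apply: contrapT => h; move: xr; apply/negP; rewrite -leNgt.
apply: exposed_ge => t t0; rewrite leNgt; apply/negP => lt.
by apply: h; exists t.
Qed.

Lemma exposed_le_self x : exposed q a x <= q x.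
Proof. by have := exposed_le x (lexx 0); rewrite scale0r addr0 mul0r subr0. Qed.

Lemma exposed_opp : exposed q a (- a) <= - q a.
Proof.
have := exposed_le (- a) ler01.
by rewrite scale1r addNr sublinear0 // mul1r sub0r.
Qed.

Lemma exposed_sublinear : sublinear (exposed q a).
Proof.
split=> [x y|c x].
  apply: (@le_all_eps _ _ _ 2) => // e e0.
  have [|t t0 ht] := @exposed_approx x (exposed q a x + e); first by rewrite ltrDl.
  have [|s s0 hs] := @exposed_approx y (exposed q a y + e); first by rewrite ltrDl.
  have := exposed_le (x + y) (addr_ge0 t0 s0).
  have := q_sub.1 (x + t%:C *: a) (y + s%:C *: a).
  by rewrite addrACA -scalerDl -rmorphD /=; lra.
rewrite le_eqVlt => /predU1P[<-|c0].
  by rewrite scale0r mul0r; apply: le_trans (exposed_le_self _) _; rewrite sublinear0.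
rewrite -ler_pdivrMl //; apply: exposed_ge => t t0.
rewrite ler_pdivrMl //; apply: le_trans (exposed_le _ (mulr_ge0 (ltW c0) t0)) _.
have -> : c%:C *: x + (c * t)%:C *: a = c%:C *: (x + t%:C *: a).
  by rewrite scalerDr scalerA -rmorphM.
by rewrite sublinearZ ?(ltW c0) // mulrBr mulrA.
Qed.

End Exposed.

(** [q] is the support function of a set of functionals which is extreme among
    those below [p]: it contains both ends of any segment whose middle it
    contains. *)
Definition facial p q := forall F G, real_linear F -> real_linear G ->
  le_fun F p -> le_fun G p -> (forall x, F x + G x <= 2 * q x) -> le_fun F q.

Lemma exposed_facial p q a : sublinear q -> facial p q -> facial p (exposed q a).
Proof.
move=> q_sub q_fac F G F_lin G_lin Fp Gp FG.
have FGq x : F x + G x <= 2 * q x.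
  by apply: le_trans (FG x) _; rewrite ler_pM2l // exposed_le_self.
have Fq := q_fac F G F_lin G_lin Fp Gp FGq.
have Gq : le_fun G q.
  by apply: (q_fac G F) => // x; rewrite addrC.
have Fa : F a = q a.
  apply/le_anti; rewrite Fq /=.
  have := FG (- a); rewrite (real_linearN a F_lin) (real_linearN a G_lin).
  have := exposed_opp a q_sub.
  by have := Gq a; lra.
move=> x; apply: exposed_ge => t t0.
by have := Fq (x + t%:C *: a); rewrite F_lin.1 F_lin.2 Fa; lra.
Qed.

(** A minimal facial sublinear functional equals each of its exposed
    functionals, so it is linear; being facial it is then extreme. This proves
    at once the extension theorem and the existence of extreme points. *)
Theorem extreme_functional p a : sublinear p -> exists F,
  [/\ real_linear F, le_fun F p, F a = p a &
  forall G G', real_linear G -> real_linear G' -> le_fun G p -> le_fun G' p ->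
    (forall x, G x + G' x = 2 * F x) -> G = F].
Proof.
move=> p_sub.
pose good q := [/\ sublinear q, facial p q & le_fun q (exposed p a)].
have good0 : good (exposed p a).
  split; [exact: exposed_sublinear | | by move=> x].
  by apply: exposed_facial => // F G _ _ Fp _ _.
have good_le q x : good q -> q x <= p x.
  by move=> [_ _ h]; apply: le_trans (h x) _; exact: exposed_le_self.
pose T := {q : V -> R | good q}.
pose le (q q' : T) : bool := `[< le_fun (sval q') (sval q) >].
have [||||[q q_good] q_min] := @Zorn T le.
- by move=> q; apply/asboolP => x.
- move=> q r s /asboolP qr /asboolP rs; apply/asboolP => x.
  exact: le_trans (rs x) (qr x).
- move=> [q gq] [r gr] /asboolP /= qr /asboolP /= rq.
  have e : q = r by apply/funext => x; apply/le_anti; rewrite qr rq.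
  by move: gq; rewrite e => gq; congr exist; exact: Prop_irrelevance.
- move=> S S_tot; have [->|/set0P [q0 Sq0]] := eqVneq S set0.
    by exists (exist _ _ good0).
  pose E x := [set sval q x | q in S].
  have E_lb x : lbound (E x) (- p (- x)).
    move=> _ [[q gq] Sq <-] /=; have [q_sub _ _] := gq.
    apply: le_trans (sublinear_opp x q_sub); rewrite lerN2; exact: good_le.
  have E_ex x : E x !=set0 by exists (sval q0 x), q0.
  pose m x := inf (E x).
  have m_le (q : T) x : S q -> m x <= sval q x.
    by move=> Sq; apply: inf_le_elt (@E_lb x) _; exists q.
  have m_ge x l : (forall q : T, S q -> l <= sval q x) -> l <= m x.
    by move=> h; apply: lb_le_inf => // _ [q Sq <-]; exact: h.
  have m_approx x r : m x < r -> exists2 q : T, S q & sval q x < r.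
    move=> xr; apply: contrapT => h; move: xr; apply/negP; rewrite -leNgt.
    apply: m_ge => q Sq; rewrite leNgt; apply/negP => lt.
    by apply: h; exists q.
  have m_good : good m.
    split.
    - split=> [x y|t x t0].
        apply: (@le_all_eps _ _ _ 2) => // e e0.
        have [|q Sq hq] := m_approx x (m x + e); first by rewrite ltrDl.
        have [|r Sr hr] := m_approx y (m y + e); first by rewrite ltrDl.
        have [[q_sub _ _] [r_sub _ _]] := (svalP q, svalP r).
        case: (S_tot q r Sq Sr) => /asboolP h.
          have := m_le r (x + y) Sr; have := r_sub.1 x y; have := h x; lra.
        have := m_le q (x + y) Sq; have := q_sub.1 x y; have := h y; lra.
      apply: (@le_all_eps _ _ _ t) => // e e0; rewrite -mulrDr.
      have [|q Sq hq] := m_approx x (m x + e); first by rewrite ltrDl.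
      have [q_sub _ _] := svalP q.
      apply: le_trans (m_le q _ Sq) _; apply: le_trans (q_sub.2 t x t0) _.
      by rewrite ler_wpM2l // ltW.
    - move=> F G F_lin G_lin Fp Gp FG x; apply: m_ge => q Sq.
      have [_ q_fac _] := svalP q; apply: (q_fac F G) => // y.
      by apply: le_trans (FG y) _; rewrite ler_pM2l // m_le.
    - move=> x; apply: le_trans (m_le q0 x Sq0) _.
      by have [_ _ ] := svalP q0.
  exists (exist _ m m_good) => q Sq; apply/asboolP => x /=.
  exact: m_le.
have [q_sub q_fac q_le] := q_good.
have qN b : q (- b) = - q b.
  have b_good : good (exposed q b).
    split; [exact: exposed_sublinear | exact: exposed_facial | move=> x].
    exact: le_trans (exposed_le_self _ _ _) (q_le x).
  have /(congr1 sval) /= e : exist good _ b_good = exist good q q_good.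
    by apply: q_min; apply/asboolP => x /=; exact: exposed_le_self.
  apply/le_anti/andP; split; last by have := sublinear_opp b q_sub; lra.
  by rewrite -{1}e; exact: exposed_opp.
have q_lin : real_linear q.
  split=> [x y|t x].
    apply/le_anti; rewrite q_sub.1 /=.
    by have := q_sub.1 (x + y) (- y); rewrite addrK qN; lra.
  have [t0|t0] := leP 0 t; first exact: sublinearZ.
  have nt : 0 <= - t by rewrite oppr_ge0 ltW.
  have := sublinearZ x q_sub nt; rewrite rmorphN scaleNr qN; lra.
exists q; split=> //; first by move=> x; exact: good_le.
  apply/le_anti; rewrite good_le //=.
  have := q_le (- a); rewrite qN; have := exposed_opp a p_sub; lra.
move=> G G' G_lin G'_lin Gp G'p GG'.
have Gq : le_fun G q by apply: (q_fac G G') => // x; rewrite GG'.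
apply/funext => x; apply/le_anti; rewrite Gq /=.
by have := Gq (- x); rewrite qN real_linearN //; lra.
Qed.

End Extreme.

(** * Geometry of Hilbert spaces *)

Section HilbertGeometry.
Variables (R : realType) (H : hilbertType R).
Implicit Types (u v w : H) (V : set H).

Lemma hdot_linear k u v w :
  (hdot : H -> H -> R[i]) (k *: u + v) w = k * hdot u w + hdot v w.
Proof. by rewrite linearPl. Qed.

Lemma hdot_conj u v : (hdot : H -> H -> R[i]) v u = Num.conj (hdot u v).
Proof. by have := hermitian_subproof (s := hdot : {dot H for _}) v u; rewrite mul1r. Qed.

Lemma hdot_ge0 u : 0 <= (hdot : H -> H -> R[i]) u u.
Proof. by rewrite hdot_norm exprn_ge0. Qed.

Definition hdot_preinner : preinner H := PreInner hdot_linear hdot_conj hdot_ge0.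

Local Notation hd := hdot_preinner.

Lemma re_hdot_norm u : re_pin hd u u = nrm u ^+ 2.
Proof. by rewrite /re_pin /= hdot_norm normE -rmorphXn. Qed.

Lemma nrm_comb (s t : R) u v : nrm (s%:C *: u + t%:C *: v) ^+ 2 =
  s ^+ 2 * nrm u ^+ 2 + t ^+ 2 * nrm v ^+ 2 + 2 * s * t * re_pin hd u v.
Proof. by rewrite -!re_hdot_norm re_pin_comb. Qed.

Lemma closed_tends V (u : nat -> H) v : closed V -> (forall n, V (u n)) ->
  tends (@nrm R H) u v -> V v.
Proof.
move=> V_closed uV uv; apply: (closed_cvg V V_closed (F := \oo) (u_ := u)).
  by near=> n; exact: uV.
apply/cvgrPdist_lt => e /realC_gt0[e0 ->]; have [n0 hn] := uv _ e0.
by exists n0 => // n /hn /=; rewrite distrC normE ltcR.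
Unshelve. all: by end_near. Qed.

Definition subspace V := V 0 /\ forall k u v, V u -> V v -> V (k *: u + v).

(** Otherwise a small real multiple of [u] would shorten [w]. *)
Lemma re_orth_of_min V w : subspace V ->
  (forall u, V u -> nrm w <= nrm (w + u)) -> forall u, V u -> re_pin hd w u = 0.
Proof.
move=> [V0 VL] wmin u Vu; set r := re_pin hd w u.
have VZ k : V (k *: u) by rewrite -[k *: u]addr0; exact: VL.
(* The best multiple of [u] is [- r / |u|^2]; adding 1 to the denominator
   avoids the case [u = 0] and still yields a contradiction unless [r = 0]. *)
pose c := nrm u ^+ 2 + 1.
have c0 : 0 < c by rewrite ltr_wpDl ?sqr_ge0.
have /wmin : V ((- (r / c))%:C *: u) by exact: VZ.
rewrite -(@ler_pXn2r _ 2) ?nnegrE ?nrm_ge0 //.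
have := nrm_comb 1 (- (r / c)) w u; rewrite scale1r => ->.
rewrite -/r => h; apply/eqP; rewrite -sqrf_eq0; apply/eqP/le_anti.
rewrite sqr_ge0 andbT.
have : 0 <= c ^+ 2 * ((- (r / c)) ^+ 2 * nrm u ^+ 2 + 2 * 1 * - (r / c) * r).
  by apply: mulr_ge0; [exact: sqr_ge0 | move: h; lra].
have -> : c ^+ 2 * ((- (r / c)) ^+ 2 * nrm u ^+ 2 + 2 * 1 * - (r / c) * r) =
    r ^+ 2 * (nrm u ^+ 2 - 2 * c) by field; rewrite gt_eqF.
have u0 := sqr_ge0 (nrm u); rewrite /c => h2.
have r0 := sqr_ge0 r.
nra.
Qed.

(** The projection is the nearest point of [V]: a minimizing sequence is Cauchy
    by the parallelogram identity. Orthogonality for the complex form follows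
    from its real part, applied to [i x]. *)
Lemma orthogonal_projection V v : closed V -> subspace V ->
  exists2 w, V w & forall u, V u -> (hdot : H -> H -> R[i]) (v - w) u = 0.
Proof.
move=> V_closed V_sub; have [V0 VL] := V_sub.
pose D := [set nrm (v - u) ^+ 2 | u in V].
have D_lb : lbound D 0 by move=> _ [u _ <-]; exact: sqr_ge0.
have D_inf : has_inf D by split; [exists (nrm (v - 0) ^+ 2), 0 | exists 0].
pose d := inf D.
have d_le u : V u -> d <= nrm (v - u) ^+ 2.
  by move=> Vu; apply: inf_le_elt D_lb _; exists u.
have near_min n : exists2 u, V u & nrm (v - u) ^+ 2 < d + n.+1%:R^-1.
  have [|_ [u Vu <-] lt] := @inf_adherent _ D (n.+1%:R^-1) _ D_inf.
    by rewrite invr_gt0.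
  by exists u.
pose u n := s2val (cid2 (near_min n)).
have uV n : V (u n) := s2valP (cid2 (near_min n)).
have u_min n : nrm (v - u n) ^+ 2 < d + n.+1%:R^-1 := s2valP' (cid2 (near_min n)).
(* The parallelogram identity, with the midpoint of [u m] and [u n] in [V]. *)
have parallelogram m n : nrm (u m - u n) ^+ 2 <=
    2 * (nrm (v - u m) ^+ 2 - d) + 2 * (nrm (v - u n) ^+ 2 - d).
  have e1 := nrm_comb 1 (-1) (v - u n) (v - u m).
  have e2 := nrm_comb (2^-1) (2^-1) (v - u n) (v - u m).
  have E1 : 1%:C *: (v - u n) + (-1)%:C *: (v - u m) = u m - u n.
    by rewrite rmorphN1 scale1r scaleN1r opprB addrC addrA subrK.
  have E2 : (2^-1)%:C *: (v - u n) + (2^-1)%:C *: (v - u m) =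
      v - (2^-1)%:C *: (u n + u m).
    by linear_identity_over (R[i]); field.
  have /d_le : V ((2^-1)%:C *: (u n + u m)).
    rewrite -[_ *: _]addr0; apply: (VL) => //.
    by rewrite -[u n]scale1r; exact: VL.
  by rewrite -E2 e2 -E1 e1; lra.
have [w uw] : exists w, tends (@nrm R H) u w.
  apply: nrm_complete => e e0.
  have e4 : 0 < e ^+ 2 / 4 by rewrite divr_gt0 ?exprn_gt0.
  have [n0 _ hn0] := near_infty_natSinv_lt (PosNum e4).
  exists n0 => m n /hn0 /= hm /hn0 /= hn.
  rewrite -(@ltr_pXn2r _ 2) ?nnegrE ?nrm_ge0 ?(ltW e0) //.
  apply: le_lt_trans (parallelogram m n) _.
  have := u_min m; have := u_min n; move: hm hn.
  by move: (m.+1%:R^-1) (n.+1%:R^-1) => a b; lra.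
have Vw := closed_tends V_closed uV uw.
have w_min : nrm (v - w) ^+ 2 <= d.
  have l := tends_nrm (tendsB (tends_cst v) uw).
  rewrite -[leRHS]addr0 expr2; apply: (ler_cvg_to (cvgM l l) (cvgD (cvg_cst d) (cvg_harmonic (R := R)))).
  by near=> n; have := ltW (u_min n); rewrite expr2.
have re_orth x : V x -> re_pin hd (v - w) x = 0.
  apply: re_orth_of_min => // y Vy.
  rewrite -(@ler_pXn2r _ 2) ?nnegrE ?nrm_ge0 //; apply: le_trans w_min _.
  have -> : v - w + y = v - (w - y) by rewrite opprB addrA addrAC.
  by apply: d_le; rewrite addrC -scaleN1r; exact: VL.
exists w => // x Vx; apply: complex_ext; first exact: re_orth.
have := re_orth ('i *: x); rewrite /re_pin (pinZr hd) Re_conji; apply.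
by rewrite -['i *: x]addr0; exact: VL.
Unshelve. all: by end_near. Qed.

End HilbertGeometry.

(** * States and their representations *)

Section States.
Variables (R : realType) (A : unitalStarAlgType R) (hA : bounded_algebra A).
Local Notation e := (aone : A).
Local Notation pos := (apos A).
Implicit Types (a b x y : A) (r t : R) (F : A -> R).

Definition real_part x : A := (2^-1)%:C *: (x + star x).

Lemma real_part_sa x : star (real_part x) = real_part x.
Proof. by rewrite /real_part; star_identity R; ring. Qed.

Lemma real_part_id x : star x = x -> real_part x = x.
Proof. by move=> x_sa; rewrite /real_part x_sa; linear_identity_over R[i]; field. Qed.

Lemma real_partD x y : real_part (x + y) = real_part x + real_part y.
Proof. by rewrite /real_part; star_identity R; ring. Qed.

Lemma real_partZ t x : real_part (t%:C *: x) = t%:C *: real_part x.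
Proof. by rewrite /real_part; star_identity R; ring. Qed.

(** The functionals below the gauge are the real parts of the positive
    functionals of norm at most 1. *)
Definition gauge x : R := inf [set r | 0 < r /\ pos (r%:C *: e - real_part x)].

Lemma gauge_le r x : 0 < r -> pos (r%:C *: e - real_part x) -> gauge x <= r.
Proof. by move=> r0 h; apply: (@inf_le_elt _ _ 0) => // s [/ltW]. Qed.

Lemma gauge_has_inf x : has_inf [set r | 0 < r /\ pos (r%:C *: e - real_part x)].
Proof.
split; last by exists 0 => s [/ltW].
by have [r r0 [_ h]] := sa_bounded hA (real_part_sa x); exists r.
Qed.

Lemma gauge_ge0 x : 0 <= gauge x.
Proof. by apply: lb_le_inf (gauge_has_inf x).1 _ => r [/ltW]. Qed.

Lemma gauge_lt r x : gauge x < r -> pos (r%:C *: e - real_part x).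
Proof.
move=> xr; have [|s [s0 h] sr] := @inf_adherent _ _ (r - gauge x) _ (gauge_has_inf x).
  by rewrite subr_gt0.
by move: sr; rewrite -/(gauge x) addrC subrK => /ltW sr; exact: apos_scalar_le sr _.
Qed.

Lemma gauge_sublinear : sublinear gauge.
Proof.
split=> [x y|t x t0].
  apply: (@le_all_eps _ _ _ 2) => // d d0.
  have [hx hy] : gauge x < gauge x + d /\ gauge y < gauge y + d by rewrite !ltrDl.
  have hxy := aposD (gauge_lt hx) (gauge_lt hy).
  rewrite (_ : _ + 2 * d = gauge x + d + (gauge y + d)); last by ring.
  apply: gauge_le; first by have := gauge_ge0 x; have := gauge_ge0 y; lra.
  suff -> : (gauge x + d + (gauge y + d))%:C *: e - real_part (x + y) =
    ((gauge x + d)%:C *: e - real_part x) + ((gauge y + d)%:C *: e - real_part y) by [].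
  by rewrite real_partD; linear_identity_over R[i]; ring.
apply: (@le_all_eps _ _ _ (t + 1)); first lra.
move=> d d0; have hx : gauge x < gauge x + d by rewrite ltrDl.
apply: gauge_le; first by have := gauge_ge0 x; nra.
rewrite real_partZ.
have -> : (t * gauge x + (t + 1) * d)%:C *: e - t%:C *: real_part x =
    t%:C *: ((gauge x + d)%:C *: e - real_part x) + d%:C *: e.
  by linear_identity_over R[i]; ring.
by apply: aposD; [apply: aposZ => //; exact: gauge_lt | apply: apos_scalar; exact: ltW].
Qed.

Lemma gauge_star_mul x : gauge (star x ** x) = anorm x ^+ 2.
Proof.
have x_sa : star (star x ** x) = star x ** x by rewrite starM starK.
apply/le_anti/andP; split; apply: le_of_all_gt => r xr.
  have r0 : 0 < r := le_lt_trans (sqr_ge0 _) xr.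
  apply: gauge_le => //; rewrite real_part_id // -[r]sqr_sqrtr ?(ltW r0) //.
  apply: anorm_lt => //; rewrite -(@ltr_pXn2r _ 2) ?nnegrE ?anorm_ge0 ?sqrtr_ge0 //.
  by rewrite [ltRHS]sqr_sqrtr ?(ltW r0).
have r0 : 0 < r := le_lt_trans (gauge_ge0 _) xr.
rewrite -[leRHS]sqr_sqrtr ?(ltW r0) // ler_pXn2r ?nnegrE ?anorm_ge0 ?sqrtr_ge0 //.
apply: anorm_le; first by rewrite sqrtr_gt0.
by have := gauge_lt xr; rewrite real_part_id // sqr_sqrtr ?(ltW r0).
Qed.

Record state F : Prop := State {
  state_linear : real_linear F ;
  state_star : forall x, F (star x) = F x ;
  state_ge0 : forall x, 0 <= F (star x ** x) ;
  state_one : F e <= 1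
}.

Lemma state_apos F x : state F -> pos x -> 0 <= F x.
Proof.
move=> F_st [n [b ->]]; have [FD _] := state_linear F_st.
elim/big_ind: _ => //; first by rewrite (real_linear0 (state_linear F_st)).
  by move=> y z y0 z0; rewrite FD addr_ge0.
by move=> i _; exact: state_ge0.
Qed.

Lemma state_le_gauge F : state F -> le_fun F gauge.
Proof.
move=> F_st x; have [FD FZ] := state_linear F_st.
apply: le_of_all_gt => r xr; have r0 : 0 < r := le_lt_trans (gauge_ge0 _) xr.
have := state_apos F_st (gauge_lt xr).
rewrite (real_linearB _ _ (state_linear F_st)) FZ /real_part FZ FD (state_star F_st).
by have := state_one F_st; nra.
Qed.

(** The gauge vanishes on [i y] for [y] self-adjoint and on the opposite of the
    cone, which makes [F] hermitian and positive. *)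
Lemma le_gauge_state F : real_linear F -> le_fun F gauge -> state F.
Proof.
move=> F_lin Fg.
have skew y : star y = - y -> F y = 0.
  have half z : star z = - z -> F z <= 0.
    move=> zs; apply: le_trans (Fg z) _; apply: le_of_all_gt => r r0.
    apply: gauge_le => //; rewrite /real_part zs subrr scaler0 subr0.
    by apply: apos_scalar; exact: ltW.
  move=> ys; apply/le_anti; rewrite half //=.
  by have := half (- y); rewrite starN ys (real_linearN _ F_lin) => /(_ erefl); lra.
split=> //.
- move=> x; apply/eqP; rewrite -subr_eq0 -(real_linearB _ _ F_lin); apply/eqP.
  by apply: skew; rewrite starB starK opprB.
- move=> x; suff : F (- (star x ** x)) <= 0 by rewrite (real_linearN _ F_lin); lra.
  apply: le_trans (Fg _) _; apply: le_of_all_gt => r r0.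
  apply: gauge_le => //; rewrite real_part_id ?starN ?starM ?starK // opprK.
  by apply: aposD; [apply: apos_scalar; exact: ltW | exact: apos_star_mul].
- apply: le_trans (Fg _) _; apply: gauge_le => //.
  by rewrite real_part_id ?star1 // scale1r subrr; exact: apos0.
Qed.

(** Extreme functionals below the gauge are extreme states, and the gauge of
    [x^* x] is [|x|^2]. *)
Lemma exists_extreme_state x : exists F, [/\ state F,
  F (star x ** x) = anorm x ^+ 2 &
  forall G G', state G -> state G' -> (forall y, G y + G' y = 2 * F y) -> G = F].
Proof.
have [F [F_lin Fg Fx F_ext]] := extreme_functional (star x ** x) gauge_sublinear.
exists F; split; first exact: le_gauge_state.
  by rewrite Fx gauge_star_mul.
move=> G G' G_st G'_st; apply: F_ext; try exact: state_linear.
  exact: state_le_gauge.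
exact: state_le_gauge.
Qed.

(** [|x|^2 = F (x^* x) <= (|x|^2 + d) F(e)] for every [d > 0]. *)
Lemma state_one_eq F x : state F -> F (star x ** x) = anorm x ^+ 2 -> anorm x != 0 ->
  F e = 1.
Proof.
move=> F_st Fx x0; apply/le_anti; rewrite (state_one F_st) /=.
have s0 : 0 < anorm x ^+ 2 by rewrite exprn_gt0 // lt_def x0 anorm_ge0.
rewrite -(ler_pM2l s0) mulr1.
have F0 : 0 <= F e by rewrite -[e]amul1a -{1}[e]star1; exact: state_ge0.
apply: (le_all_eps F0) => d d0.
have hd : gauge (star x ** x) < anorm x ^+ 2 + d by rewrite gauge_star_mul ltrDl.
have := state_apos F_st (gauge_lt hd).
rewrite real_part_id ?starM ?starK // (real_linearB _ _ (state_linear F_st)) Fx.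
by rewrite (state_linear F_st).2; lra.
Qed.

End States.

Section GNS.
Variables (R : realType) (A : unitalStarAlgType R) (hA : bounded_algebra A).
Variables (F : A -> R) (F_st : state F).
Local Notation e := (aone : A).
Implicit Types (a b c x y : A).

Let FD := (state_linear F_st).1.
Let FZ := (state_linear F_st).2.

(** The complex linear functional whose real part is [F]. *)
Definition complexify a : R[i] := Complex (F a) (- F ('i *: a)).

Lemma real_linear_i k a : F (k *: a) = complex.Re k * F a + complex.Im k * F ('i *: a).
Proof.
have -> : k *: a = (complex.Re k)%:C *: a + (complex.Im k)%:C *: ('i *: a).
  by rewrite scalerA -scalerDl {1}[k]complexE complexiE mulrC.
by rewrite FD !FZ.
Qed.

Lemma complexify_linear k a b : complexify (k *: a + b) = k * complexify a + complexify b.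
Proof.
have ik : 'i *: (k *: a + b) = ('i * k) *: a + 'i *: b by rewrite scalerDr scalerA.
apply: complex_ext.
  by rewrite Re_add Re_mul /= FD real_linear_i; ring.
rewrite Im_add Im_mul /= ik FD real_linear_i -complexiE Re_mul Im_mul /=; ring.
Qed.

Lemma complexify_star a : complexify (star a) = Num.conj (complexify a).
Proof.
apply: complex_ext; rewrite ?Re_conjE ?Im_conjE /=; first exact: state_star.
rewrite opprK -(state_star F_st ('i *: a)) starZi scaleNr.
by rewrite (real_linearN _ (state_linear F_st)).
Qed.

Lemma complexify_ge0 a : 0 <= complexify (star a ** a).
Proof.
have e1 : complexify (star a ** a) = Num.conj (complexify (star a ** a)).
  by rewrite -complexify_star starM starK.
have im0 : complex.Im (complexify (star a ** a)) = 0.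
  by have := congr1 (@complex.Im R) e1; rewrite Im_conjE; lra.
suff -> : complexify (star a ** a) = (F (star a ** a))%:C.
  by rewrite lecR; exact: state_ge0.
exact: complex_ext.
Qed.

Definition gns_form a b : R[i] := complexify (star b ** a).

Lemma gns_form_linear k a b c : gns_form (k *: a + b) c = k * gns_form a c + gns_form b c.
Proof. by rewrite /gns_form amulDr amulZr complexify_linear. Qed.

Lemma gns_form_conj a b : gns_form b a = Num.conj (gns_form a b).
Proof. by rewrite /gns_form -complexify_star starM starK. Qed.

Definition gns_preinner : preinner A :=
  PreInner gns_form_linear gns_form_conj complexify_ge0.

Definition gns_space : hilbertType R := hspace gns_preinner.
Local Notation N := (pin_seminorm gns_preinner).
Local Notation H := gns_space.
Local Notation emb := (emb N).

Lemma gns_seminorm_sqr a : N a ^+ 2 = F (star a ** a).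
Proof. by rewrite /= pnorm_sqr. Qed.

(** [F (b^* (r^2 - a^* a) b) >= 0] for [r] above [|a|]; the value [|a| + 1]
    suffices for continuity. *)
Lemma gns_mul_bound a b : N (a ** b) <= (anorm a + 1) * N b.
Proof.
have r0 : 0 < anorm a + 1 by have := anorm_ge0 a; lra.
rewrite -(@ler_pXn2r _ 2) ?nnegrE ?mulr_ge0 ?semi_ge0 ?(ltW r0) //.
rewrite exprMn !gns_seminorm_sqr.
have lt : anorm a < anorm a + 1 by rewrite ltrDl.
have := state_apos F_st (apos_conj b (anorm_lt hA lt)).
rewrite amulBr amulBl (real_linearB _ _ (state_linear F_st)) amulZr amula1 amulZl FZ.
by rewrite starM !amulA; lra.
Qed.

Definition gns_op a (v : H) : H := extend (N := N) (fun b => emb (a ** b) : H) v.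

Lemma gns_op_linear_emb a : linear (fun b => emb (a ** b) : H).
Proof. by move=> k b c; rewrite amulDr amulZr embD embZ. Qed.

Lemma gns_op_bound_emb a b : nrm (emb (a ** b) : H) <= (anorm a + 1) * N b.
Proof. by rewrite (nrm_emb N); exact: gns_mul_bound. Qed.

Lemma gns_op_emb a b : gns_op a (emb b) = emb (a ** b).
Proof. exact: (extend_emb (gns_op_linear_emb a) (gns_op_bound_emb a)). Qed.

Lemma gns_op_approx a u v : approx (N := N) u v ->
  approx (N := N) (fun n => a ** u n) (gns_op a v).
Proof. exact: (extend_approx (gns_op_linear_emb a) (gns_op_bound_emb a)). Qed.

Lemma gns_op_linear a : linear (gns_op a).
Proof. exact: (extend_linear (gns_op_linear_emb a) (gns_op_bound_emb a)). Qed.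

Lemma gns_op_bound a v : nrm (gns_op a v) <= (anorm a + 1) * nrm v.
Proof. exact: (extend_bound (gns_op_linear_emb a) (gns_op_bound_emb a)). Qed.

End GNS.

Lemma linear_bounded_continuous_nrm (R : realType) (V W : normedModType R[i])
    (f : V -> W) (M : R) : linear f -> (forall v, nrm (f v) <= M * nrm v) ->
  continuous f.
Proof.
move=> f_lin fM v.
have fB a b : f (a - b) = f a - f b.
  pose fL : {linear V -> W} := HB.pack f (GRing.isLinear.Build R[i] V W *:%R f f_lin).
  exact: (linearB fL).
have M0 : 0 < `|M| + 1 by rewrite ltr_wpDl.
apply/cvgrPdist_lt => d /realC_gt0[d0 ->].
have dM : 0 < (complex.Re d / (`|M| + 1))%:C :> R[i] by rewrite ltcR divr_gt0.
have /cvgrPdist_lt/(_ _ dM) : id @ v --> v by exact: cvg_id.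
apply: filterS => w; rewrite !normE !ltcR /= ltr_pdivlMr // -fB.
apply: le_lt_trans; apply: le_trans (fM _) _; rewrite mulrC.
apply: ler_wpM2l; first exact: nrm_ge0.
by apply: le_trans (ler_norm M) _; rewrite lerDl.
Qed.

Section GNSRep.
Variables (R : realType) (A : unitalStarAlgType R) (hA : bounded_algebra A).
Variables (F : A -> R) (F_st : state F).
Local Notation H := (gns_space F_st).
Local Notation N := (pin_seminorm (gns_preinner F_st)).
Local Notation pi := (@gns_op _ _ _ F_st).
Implicit Types (a b x : A) (u v : H).

Lemma gns_star_rep : star_rep pi.
Proof.
split.
- move=> a; split; first exact: gns_op_linear.
  exact: (linear_bounded_continuous_nrm (gns_op_linear hA a) (gns_op_bound hA a)).
- move=> v k a b; have [w wv] := approx_exists v.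
  apply: (approx_eq (gns_op_approx hA _ wv)
    (approxD (approxZ k (gns_op_approx hA a wv)) (gns_op_approx hA b wv))) => n.
  by rewrite /= amulDl amulZl.
- move=> a b v; have [w wv] := approx_exists v.
  apply: (approx_eq (gns_op_approx hA _ wv)
    (gns_op_approx hA a (gns_op_approx hA b wv))) => n.
  by rewrite amulA.
- move=> a u v; have [s su] := approx_exists u; have [t tv] := approx_exists v.
  apply: (ctends_eq (approx_hip (gns_op_approx hA a su) tv)
    (approx_hip su (gns_op_approx hA (star a) tv))) => n.
  by rewrite /= /gns_form starM starK amulA.
Qed.

Definition gns_vector : H := emb N aone.

Lemma gns_vector_nrm x : nrm (pi x gns_vector) ^+ 2 = F (star x ** x).
Proof. by rewrite gns_op_emb // amula1 (nrm_emb N) gns_seminorm_sqr. Qed.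

Lemma gns_vector_le1 : `|gns_vector| <= 1.
Proof.
rewrite normE (nrm_emb N) lecR -(@ler_pXn2r _ 2) ?nnegrE ?semi_ge0 //.
by rewrite gns_seminorm_sqr expr1n star1 amul1a; exact: state_one.
Qed.

Lemma gns_hdot_vector a b :
  (hdot : H -> H -> R[i]) (pi a gns_vector) (pi b gns_vector) = complexify F (star b ** a).
Proof.
rewrite !gns_op_emb // !amula1.
by apply: (ctends_eq (approx_hip (approx_emb N a) (approx_emb N b))
  (v := fun=> complexify F (star b ** a))) => //; split; exact: cvg_cst.
Qed.

End GNSRep.

(** * Representations and the seminorm *)

Section RepBound.
Variables (R : realType) (A : unitalStarAlgType R) (hA : bounded_algebra A).
Variables (H : hilbertType R) (pi : A -> H -> H) (pi_rep : star_rep pi).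
Local Notation hd := (@hdot_preinner R H).
Implicit Types (a b x : A) (u v : H).

Lemma rep_comb k a b v : pi (k *: a + b) v = k *: pi a v + pi b v.
Proof. by have [_ h _ _] := pi_rep; have := h v k a b. Qed.

Lemma rep_zero v : pi 0 v = 0.
Proof.
have := rep_comb 1 0 0 v; rewrite scaler0 addr0 scale1r => /eqP.
by rewrite -[X in X == _]addr0 (inj_eq (addrI _)) eq_sym => /eqP.
Qed.

Lemma repD a b v : pi (a + b) v = pi a v + pi b v.
Proof. by rewrite -[a]scale1r rep_comb !scale1r. Qed.

Lemma repZ k a v : pi (k *: a) v = k *: pi a v.
Proof. by rewrite -[k *: a]addr0 rep_comb rep_zero addr0. Qed.

Lemma rep_star_mul b v : hd (pi (star b ** b) v) v = hd (pi b v) (pi b v).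
Proof.
have [_ _ piM pi_star] := pi_rep.
by rewrite piM /= pi_star starK.
Qed.

Lemma rep_apos x v : apos A x -> 0 <= re_pin hd (pi x v) v.
Proof.
move=> [n [b ->]]; elim/big_ind: _ => [|y z y0 z0|i _].
- by rewrite rep_zero /re_pin (pin0l hd).
- by rewrite repD /re_pin (pinD hd) Re_add addr_ge0.
- by rewrite /re_pin rep_star_mul; exact: re_pin_ge0.
Qed.

(** The unit acts as an orthogonal projection. *)
Lemma rep_one_le v : re_pin hd (pi aone v) v <= nrm v ^+ 2.
Proof.
have E : re_pin hd (pi aone v) v = nrm (pi aone v) ^+ 2.
  by rewrite -re_hdot_norm /re_pin -rep_star_mul star1 amul1a.
have := nrm_comb 1 (-1) v (pi aone v); rewrite (re_pinC hd) E.
by have := sqr_ge0 (nrm (1%:C *: v + (-1)%:C *: pi aone v)); lra.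
Qed.

(** [0 <= <pi(r^2 - x^* x) v, v> <= r^2 |v|^2 - |pi(x) v|^2]. *)
Lemma rep_bound x v : nrm (pi x v) <= anorm x * nrm v.
Proof.
apply: le_mul_of_all_gt; rewrite ?anorm_ge0 ?nrm_ge0 // => r s xr vs.
have r0 : 0 < r := le_lt_trans (anorm_ge0 _) xr.
have s0 : 0 < s := le_lt_trans (nrm_ge0 _) vs.
rewrite -(@ler_pXn2r _ 2) ?nnegrE ?nrm_ge0 ?mulr_ge0 ?(ltW r0) ?(ltW s0) //.
have := rep_apos v (anorm_lt hA xr).
rewrite -scaleN1r addrC /re_pin rep_comb repZ (pinD hd) !(pinZ hd) rep_star_mul.
rewrite Re_add Re_realM mulN1r Re_opp -!/(re_pin hd _ _) re_hdot_norm => h.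
have r2 := sqr_ge0 r.
have h1 : r ^+ 2 * re_pin hd (pi aone v) v <= r ^+ 2 * nrm v ^+ 2.
  by rewrite ler_wpM2l // rep_one_le.
have h2 : r ^+ 2 * nrm v ^+ 2 <= r ^+ 2 * s ^+ 2.
  by rewrite ler_wpM2l // ler_sqr ?nnegrE ?nrm_ge0 ?ltW.
by rewrite exprMn; lra.
Qed.

Lemma opnorm_le x : (opnorm (pi x) <= (anorm x)%:E)%E.
Proof.
apply: ge_ereal_sup => _ [v /= v1 <-]; rewrite lee_fin.
move: v1; rewrite normE -[1]/(1%:C) lecR => v1.
apply: le_trans (rep_bound x v) _.
by rewrite ler_piMr ?anorm_ge0.
Qed.

End RepBound.

(** The supremum is reached at the cyclic vector. *)
Lemma gns_opnorm (R : realType) (A : unitalStarAlgType R) (hA : bounded_algebra A)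
    (F : A -> R) (F_st : state F) (x : A) : F (star x ** x) = anorm x ^+ 2 ->
  opnorm (gns_op (F_st := F_st) x) = (anorm x)%:E.
Proof.
move=> Fx; apply/le_anti/andP; split; first exact: (opnorm_le hA (gns_star_rep hA F_st)).
apply: ereal_sup_ubound; exists (gns_vector F_st); first exact: gns_vector_le1.
suff -> : anorm x = nrm (gns_op x (gns_vector F_st)) by [].
apply/eqP; rewrite -(@eqrXn2 _ 2) ?nrm_ge0 ?anorm_ge0 //.
by rewrite (gns_vector_nrm hA F_st x) Fx.
Qed.

(** * Irreducibility *)

Section Mixtures.
Variable R : realType.
Implicit Types c f g h : R.

Lemma sum_one_sub f g : 1 = f + g -> g = 1 - f.
Proof. by move=> ->; rewrite addrC addKr. Qed.

Lemma mix_eq c f g : (1 - c) * f + g = f -> g = c * f.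
Proof. by lra. Qed.

Lemma mix_mean c f g h : f = g + h -> (1 - c) * f + g + (c * f + h) = 2 * f.
Proof. by move=> ->; ring. Qed.

Lemma ge0_at_one (A : unitalStarAlgType R) (K : A -> R) :
  (forall x, 0 <= K (star x ** x)) -> 0 <= K aone.
Proof. by move=> /(_ aone); rewrite star1 amul1a. Qed.

Lemma mixed_state (A : unitalStarAlgType R) (F K : A -> R) c :
  state F -> F aone = 1 -> 0 <= c -> real_linear K ->
  (forall x, K (star x) = K x) -> (forall x, 0 <= K (star x ** x)) ->
  c + K aone <= 1 -> state (fun a => c * F a + K a).
Proof.
move=> F_st F_one c0 K_lin K_star K_ge0 K1; have F_lin := state_linear F_st.
split.
- split=> [x y|t x]; first by rewrite F_lin.1 K_lin.1; ring.
  by rewrite F_lin.2 K_lin.2; ring.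
- by move=> x; rewrite (state_star F_st) K_star.
- by move=> x; rewrite addr_ge0 ?mulr_ge0 // (state_ge0 F_st).
- by rewrite F_one mulr1.
Qed.

End Mixtures.

Section Irreducible.
Variables (R : realType) (A : unitalStarAlgType R) (F : A -> R).
Hypothesis F_st : state F.
Hypothesis F_one : F aone = 1.
Hypothesis F_ext : forall G G', state G -> state G' ->
  (forall y, G y + G' y = 2 * F y) -> G = F.
Variables (H : hilbertType R) (pi : A -> H -> H) (xi : H).
Local Notation hd := (@hdot_preinner R H).
Hypothesis pi_rep : star_rep pi.
Hypothesis pi_one : forall v, pi aone v = v.
Hypothesis xi_cyclic : forall v, exists u : nat -> A,
  tends (@nrm R H) (fun n => pi (u n) xi) v.
Hypothesis F_vector : forall a, F a = re_pin hd (pi a xi) xi.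
Implicit Types (a b x : A) (u v w : H).

Lemma hd_adj a u v : hd (pi a u) v = hd u (pi (star a) v).
Proof. by have [_ _ _ h] := pi_rep; exact: h. Qed.

Lemma hd_orth_sum p q r u v w : p = q + r -> u = v + w ->
  hd q w = 0 -> hd r v = 0 -> hd p u = hd q v + hd r w.
Proof.
move=> -> -> qw rv; rewrite (pinD hd) !(pinDr hd) qw rv.
by rewrite addr0 add0r.
Qed.

Lemma hd_orth_r p u v w : u = v + w -> hd p w = 0 -> hd p u = hd p v.
Proof. by move=> -> pw; rewrite (pinDr hd) pw addr0. Qed.

Lemma hd_comb p q k u : hd (p - k *: q) u = hd p u - k * hd q u.
Proof. by rewrite -scaleN1r (pinD hd) !(pinZ hd) mulN1r. Qed.

Lemma pnorm_hdot v : pnorm hd v = nrm v.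
Proof. by rewrite /pnorm re_hdot_norm sqrtr_sqr ger0_norm ?nrm_ge0. Qed.

Lemma hdot_orth_dense w : (forall a, hd w (pi a xi) = 0) -> w = 0.
Proof.
move=> w0; have [u uw] := xi_cyclic w.
apply: nrm0_eq0; apply/eqP; rewrite -sqrf_eq0; apply/eqP/le_anti.
rewrite sqr_ge0 andbT; apply: (le_all_eps (nrm_ge0 w)) => d d0; rewrite add0r.
have [n0 /(_ n0 (leqnn _)) /ltW hn] := uw _ d0.
apply: le_trans (ler_wpM2l (nrm_ge0 w) hn).
rewrite nrmBC -re_hdot_norm -!pnorm_hdot; apply: le_trans (re_pin_le hd _ _).
rewrite {2}/re_pin -scaleN1r (pinDr hd) (pinZr hd) w0 mulr0 addr0; exact: lexx.
Qed.

Lemma vector_functional_state_like w (G : A -> R) :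
  (forall a, G a = re_pin hd (pi a w) w) ->
  [/\ real_linear G, forall x, G (star x) = G x & forall x, 0 <= G (star x ** x)].
Proof.
move=> GE; split.
- split=> [x y|t x]; rewrite !GE.
    by rewrite (repD pi_rep) /re_pin (pinD hd) Re_add.
  by rewrite (repZ pi_rep) /re_pin (pinZ hd) Re_realM.
- move=> x; rewrite !GE [RHS](re_pinC hd); apply: (congr1 (@complex.Re R)).
  by rewrite hd_adj starK.
- by move=> x; rewrite GE; apply: (rep_apos pi_rep); exact: apos_star_mul.
Qed.

(** Let [w] be the projection of [xi] on an invariant closed subspace, and
    [z = xi - w]. As the orthogonal complement is invariant too, [F = G + G']
    with [G] and [G'] the vector functionals of [w] and [z], whose values at the
    unit are [l = |w|^2] and [1 - l]. The states [(1 - l) F + G] and [l F + G']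
    have mean [F], so extremality gives [G = l F]. Comparing on the dense orbit
    of [xi] yields [w = l xi], and the subspace is everything unless [l = 0], in
    which case it is orthogonal to that orbit. *)
Lemma extreme_irreducible : topologically_irreducible pi.
Proof.
have [pi_op _ _ _] := pi_rep.
split.
  exists xi; apply/eqP => xi0; have := F_vector aone.
  rewrite pi_one xi0 /re_pin (pin0l hd) F_one => /eqP.
  by rewrite oner_eq0.
move=> V V_closed V0 VL V_inv.
have [w Vw w_orth] := orthogonal_projection xi V_closed (conj V0 VL).
have [z ez] : exists z, z = xi - w by exists (xi - w).
rewrite -ez in w_orth; pose l := re_pin hd w w.
pose G a := re_pin hd (pi a w) w; pose G' a := re_pin hd (pi a z) z.
have piD a u v : pi a (u + v) = pi a u + pi a v.
  by have [lin _] := pi_op a; have := lin 1 u v; rewrite !scale1r.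
have piZ a k u : pi a (k *: u) = k *: pi a u.
  have pi0 : pi a 0 = 0 by apply: (addrI (pi a 0)); rewrite -piD !addr0.
  by have [lin _] := pi_op a; have := lin k u 0; rewrite addr0 pi0 addr0.
have piB a : pi a (w - l%:C *: xi) = pi a w - l%:C *: pi a xi.
  by rewrite -scaleN1r piD !piZ scaleN1r.
have z_orth u : V u -> hd u z = 0.
  by move=> Vu; rewrite (pin_conj hd) /= w_orth // conjC0.
have xi_split : xi = w + z by rewrite ez addrC subrK.
have piS a : pi a xi = pi a w + pi a z by rewrite -piD -xi_split.
have F_split a : F a = G a + G' a.
  have E : hd (pi a xi) xi = hd (pi a w) w + hd (pi a z) z.
    apply: (hd_orth_sum (piS a) xi_split (z_orth _ (V_inv a w Vw))).
    by rewrite hd_adj; exact: w_orth _ (V_inv _ _ Vw).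
  by rewrite F_vector /re_pin E Re_add.
have [G_lin G_star G_ge0] := vector_functional_state_like (fun a => erefl (G a)).
have [G'_lin G'_star G'_ge0] := vector_functional_state_like (fun a => erefl (G' a)).
have Ge : G aone = l by rewrite /G pi_one.
have G'e : G' aone = 1 - l.
  by apply: sum_one_sub; have := F_split aone; rewrite F_one Ge.
have l0 : 0 <= l by have := ge0_at_one G_ge0; rewrite Ge.
have l1 : 0 <= 1 - l by have := ge0_at_one G'_ge0; rewrite G'e.
have st1 : state (fun a => (1 - l) * F a + G a).
  apply: (mixed_state F_st F_one l1 G_lin G_star G_ge0).
  rewrite Ge subrK; exact: lexx.
have st2 : state (fun a => l * F a + G' a).
  apply: (mixed_state F_st F_one l0 G'_lin G'_star G'_ge0).
  rewrite G'e addrC subrK; exact: lexx.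
have GF a : G a = l * F a.
  apply: mix_eq; apply: (congr1 (@^~ a) (F_ext st1 st2 _)) => y.
  exact: mix_mean (F_split y).
have w_eq : w = l%:C *: xi.
  apply/eqP; rewrite -subr_eq0; apply/eqP/hdot_orth_dense => b.
  have re0 a : complex.Re (hd (pi a (w - l%:C *: xi)) xi) = 0.
    have E : hd (pi a (w - l%:C *: xi)) xi = hd (pi a w) w - l%:C * hd (pi a xi) xi.
      rewrite (piB a) hd_comb.
      by rewrite (hd_orth_r xi_split (z_orth _ (V_inv a w Vw))).
    have := GF a; rewrite F_vector /G /re_pin => h.
    by rewrite E Re_add Re_opp Re_realM h subrr.
  rewrite -[b]starK -hd_adj.
  apply: complex_ext; first exact: re0.
  have := re0 ('i *: star b).
  rewrite (repZ pi_rep) (pinZ hd) -complexiE Re_mul /= mul0r mul1r sub0r => /eqP.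
  by rewrite oppr_eq0 => /eqP.
have [l_eq0|l_neq0] := eqVneq l 0; [left | right].
  apply/seteqP; split=> [v Vv|v ->//]; apply: hdot_orth_dense => a.
  rewrite -[a]starK -hd_adj xi_split w_eq l_eq0 scale0r add0r.
  by apply: z_orth; exact: V_inv.
apply/seteqP; split=> // v _; have [u uv] := xi_cyclic v.
apply: (closed_tends V_closed _ uv) => n; apply: V_inv.
have -> : xi = (l%:C)^-1 *: w + 0.
  by rewrite addr0 w_eq scalerA mulVf ?scale1r //; exact: realC_neq0.
exact: VL.
Qed.

End Irreducible.

Section GNSIrreducible.
Variables (R : realType) (A : unitalStarAlgType R) (hA : bounded_algebra A).
Variables (F : A -> R) (F_st : state F).
Local Notation H := (gns_space F_st).
Local Notation pi := (@gns_op _ _ _ F_st).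
Local Notation xi := (gns_vector F_st).

Lemma gns_dense v : exists u : nat -> A, tends (@nrm R H) (fun n => pi (u n) xi) v.
Proof.
have [u uv] := approx_exists v; exists u.
rewrite (_ : (fun n => _) = fun n => emb _ (u n)) //.
by apply/funext => n; rewrite gns_op_emb // amula1.
Qed.

Lemma gns_op_one v : pi aone v = v.
Proof.
have [u uv] := approx_exists v.
by apply: (approx_eq (gns_op_approx hA aone uv) uv) => n; rewrite amul1a.
Qed.

Lemma gns_state_vector a : F a = re_pin (@hdot_preinner R H) (pi a xi) xi.
Proof.
have h := gns_hdot_vector hA F_st a aone; rewrite gns_op_one star1 amul1a in h.
exact: (esym (congr1 (@complex.Re R) h)).
Qed.

Lemma gns_irreducible : F aone = 1 ->
  (forall G G', state G -> state G' -> (forall y, G y + G' y = 2 * F y) -> G = F) ->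
  topologically_irreducible pi.
Proof.
move=> F_one F_ext; apply: (extreme_irreducible F_st F_one F_ext (gns_star_rep hA F_st)
  gns_op_one gns_dense gns_state_vector).
Qed.

End GNSIrreducible.

(** * The norm of the enveloping algebra and the *-radical *)

Section Assembly.
Variables (R : realType) (A : unitalStarAlgType R) (hA : bounded_algebra A).
Implicit Types (a x : A).

(** One inequality is the bound of morphisms by the seminorm; the other comes
    from factoring the completion through [B] by a contraction. *)
Lemma universal_norm (B : cstarAlgType R) (iota : A -> B) :
  universal_enveloping iota -> forall x, `|iota x| = (anorm x)%:C.
Proof.
move=> [iota_mor univ] x; rewrite normE; congr (_%:C).
have [psi [[psi_mor psi_iota] _]] := univ _ _ (env_emb_morphism hA).
apply/le_anti; rewrite star_morphism_anorm //=.
by rewrite -(nrm_env_emb hA) -psi_iota; exact: star_morphism_contractive.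
Qed.

Lemma anorm_rep_attained x : exists2 s, rep_norms x s & s = (anorm x)%:E.
Proof.
have [F [F_st Fx _]] := exists_extreme_state hA x.
exists (opnorm (gns_op (F_st := F_st) x)); last exact: gns_opnorm.
exists (gns_space F_st), (@gns_op _ _ _ F_st).
exact: (conj (gns_star_rep hA F_st) erefl).
Qed.

Lemma rep_norms_bounds x s : rep_norms x s -> (0 <= s /\ s <= (anorm x)%:E)%E.
Proof.
move=> [H [pi [pi_rep ->]]]; split; last exact: opnorm_le.
apply: (@le_trans _ _ (nrm (pi x 0))%:E); first by rewrite lee_fin nrm_ge0.
by apply: ereal_sup_ubound; exists 0; rewrite //= normr0.
Qed.

Lemma anorm_ereal_sup x : (anorm x)%:E = ereal_sup (rep_norms x).
Proof.
apply/le_anti/andP; split.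
  by have [s hs <-] := anorm_rep_attained x; exact: ereal_sup_ubound.
by apply: ge_ereal_sup => s /rep_norms_bounds[].
Qed.

Lemma sup_sqr_anorm x :
  ereal_sup [set (s ^+ 2)%E | s in rep_norms x] = (anorm x ^+ 2)%:E.
Proof.
apply/le_anti/andP; split.
  apply: ge_ereal_sup => _ [s /rep_norms_bounds[s0 sx] <-].
  by rewrite expe2 expr2 EFinM lee_pmul.
have [s hs es] := anorm_rep_attained x.
by apply: ereal_sup_ubound; exists s => //; rewrite es EFin_expe.
Qed.

(** With [x x^*] in place of [x^* x] this is the norm of [x^*], which is that
    of [x]. *)
Lemma inf_scalar_anorm x :
  ereal_inf [set r%:E | r in [set r : R | 0 < r /\
    exists2 f : A, apos A f & x ** star x + f = r%:C *: aone]] = (anorm x ^+ 2)%:E.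
Proof.
apply/le_anti/andP; split.
  apply/lee_addgt0Pr => d d0; apply: ereal_inf_lbound.
  exists (anorm x ^+ 2 + d); last by rewrite EFinD.
  split; first by rewrite ltr_wpDl ?sqr_ge0.
  exists ((anorm x ^+ 2 + d)%:C *: aone - x ** star x); last by rewrite addrC subrK.
  have xd : gauge (star (star x) ** star x) < anorm x ^+ 2 + d.
    by rewrite gauge_star_mul // anorm_star // ltrDl.
  by have := gauge_lt hA xd; rewrite starK real_part_id // starM starK.
apply: le_ereal_inf_tmp => _ [r [r0 [f f_pos fr]] <-]; rewrite lee_fin.
rewrite -(anorm_star hA) -[leRHS]sqr_sqrtr ?(ltW r0) //.
rewrite ler_pXn2r ?nnegrE ?anorm_ge0 ?sqrtr_ge0 //.
apply: anorm_le; first by rewrite sqrtr_gt0.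
by rewrite sqr_sqrtr ?(ltW r0) // -fr starK addrC addKr.
Qed.

(** An element of nonzero seminorm is detected at the cyclic vector of an
    irreducible representation. *)
Lemma null_space_radical : [set x | anorm x = 0] = star_radical A.
Proof.
apply/seteqP; split=> x.
  move=> /= x0 H pi pi_rep _ v; apply: nrm0_eq0; apply/le_anti.
  rewrite nrm_ge0 andbT; have := rep_bound hA pi_rep x v.
  by rewrite x0 mul0r.
move=> x_rad; apply/eqP; apply: contrapT => /negP x0.
have [F [F_st Fx F_ext]] := exists_extreme_state hA x.
have F1 := state_one_eq hA F_st Fx x0.
have := x_rad _ _ (gns_star_rep hA F_st) (gns_irreducible hA F_st F1 F_ext) (gns_vector F_st).
move=> /(congr1 (fun v => nrm v ^+ 2)); rewrite gns_vector_nrm // Fx nrm0 expr0n /=.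
by move=> /eqP; rewrite sqrf_eq0 (negbTE x0).
Qed.

Lemma null_space_sums : [set x | anorm x = 0] =
  [set x : A | forall eps : R, 0 < eps -> exists n (y : 'I_n.+1 -> A),
     star x ** x + \sum_(j < n.+1) star (y j) ** y j = eps%:C *: aone].
Proof.
apply/seteqP; split=> x /=.
  move=> /(anorm_eq0P hA) h d /h [n [y ey]]; exists n, y.
  by rewrite -ey addrC subrK.
move=> h; apply/(anorm_eq0P hA) => d /h[n [y <-]]; exists n, y.
by rewrite addrC addKr.
Qed.

(** An injective morphism to a C*-algebra is bounded by the seminorm, so the
    null space is zero; conversely the completion is such a C*-algebra. *)
Lemma representable_radical : cstar_representable A <-> star_radical A = [set 0].
Proof.
rewrite -null_space_radical; split.
  move=> [B [S [phi [_ phi_mor [_ phi_inj _]]]]].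
  have anorm0 : anorm (0 : A) = 0.
    by have := anormZ hA 0 0; rewrite scale0r /nrm normr0 mul0r.
  apply/seteqP; split=> [x /= x0|_ ->//].
  have phi0 y : anorm y = 0 -> phi y = 0.
    move=> y0; apply: nrm0_eq0; apply/le_anti; rewrite nrm_ge0 andbT -y0.
    exact: star_morphism_anorm.
  by apply: phi_inj; rewrite ?inE // !phi0.
move=> rad0; have [env_lin envM env_star] := env_emb_morphism hA.
pose envL : {linear A -> envelope hA} := HB.pack (env_emb hA)
  (GRing.isLinear.Build R[i] A (envelope hA) *:%R (env_emb hA) env_lin).
exists (envelope hA), (range (env_emb hA)), (env_emb hA); split.
- split.
  + by exists 0 => //; exact: (linear0 envL).
  + by move=> k _ _ [a _ <-] [b _ <-]; exists (k *: a + b); last exact: env_lin.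
  + by move=> _ _ [a _ <-] [b _ <-]; exists (a ** b); last exact: envM.
  + by move=> _ [a _ <-]; exists (star a); last exact: env_star.
- exact: env_emb_morphism.
split=> [a _|a b _ _ ab|_ [a _ <-]]; [by exists a | | by exists a].
apply/eqP; rewrite -subr_eq0; apply/eqP.
have emb_ab : env_emb hA (a - b) = env_emb hA a - env_emb hA b := linearB envL a b.
suff : [set 0] (a - b) by [].
by rewrite -rad0 /= -(nrm_env_emb hA) emb_ab ab subrr nrm0.
Qed.

End Assembly.

Theorem theorem1 (R : realType) (A : unitalStarAlgType R) (hA : bounded_algebra A) :
  [/\ (* (1) *)
      [/\ exists (B : cstarAlgType R) (iota : A -> B),
            universal_enveloping iota,
          forall (B : cstarAlgType R) (iota : A -> B),
            universal_enveloping iota ->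
            forall x : A, `|iota x| = (anorm x)%:C,
          forall x : A, (anorm x)%:E = ereal_sup (rep_norms x),
          forall x : A,
            ereal_sup [set (s ^+ 2)%E | s in rep_norms x] =
            ereal_inf [set r%:E | r in [set r : R | 0 < r /\
              exists2 f : A, apos A f & x ** star x + f = r%:C *: aone]]
        & forall a : A, selfadj A a -> norm_sa a = anorm a],
      (* (2) *)
      [set x : A | anorm x = 0] = star_radical A /\
      [set x : A | anorm x = 0] =
        [set x : A | forall eps : R, 0 < eps ->
          exists n (y : 'I_n.+1 -> A),
            star x ** x + \sum_(j < n.+1) star (y j) ** y j = eps%:C *: aone]
    & (* (3) *)
      cstar_representable A <-> star_radical A = [set 0]].
Proof.
split.
- split.
  + by exists (envelope hA), (env_emb hA); exact: envelope_universal.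
  + by move=> B iota; exact: universal_norm.
  + exact: anorm_ereal_sup.
  + by move=> x; rewrite sup_sqr_anorm // inf_scalar_anorm.
  + by move=> a; exact: norm_sa_anorm.
- by split; [exact: null_space_radical | exact: null_space_sums].
- exact: representable_radical.
Qed.
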